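(* For every integer $k\ge 1$, the class $\mathcal D^k_d$ of all finite $k$-orientations with $d$-closures has irreducible structure faithful coherent EPPA.
   Context: Structures and maps. All structures here are in languages with trivial permutation group. A language consists of relation symbols $R$ and function symbols $F$ with arities; a structure $\mathbf A$ has a vertex set $A$, relations $R_{\mathbf A}\subseteq A^{a(R)}$ and set-valued functions $F_{\mathbf A}\colon A^{a(F)}\to\mathcal P(A)$. An embedding $f\colon\mathbf A\to\mathbf B$ is an injective map $A\to B$ with $\bar x\in R_{\mathbf A}\iff f(\bar x)\in R_{\mathbf B}$ and $f(F_{\mathbf A}(\bar x))=F_{\mathbf B}(f(\bar x))$ for all symbols $R,F$ and tuples $\bar x$; isomorphisms are bijective embeddings. $\mathbf A\subseteq\mathbf B$ is a substructure if the inclusion is an embedding (so substructures are closed under all functions). The closure $\mathrm{Cl}_{\mathbf A}(x)$ is the smallest substructure of $\mathbf A$ containing $x$. $k$-orientations. An oriented graph is a directed graph (binary relation $E$) such that if there is an edge from $u$ to $v$ then there is no edge from $v$ to $u$. A $k$-orientation is an oriented graph in which every vertex has out-degree at most $k$; a root is a vertex of out-degree strictly smaller than $k$. $\mathcal D^k$ is the class of all finite $k$-orientations. For a $k$-orientation $\mathbf G$, $s(\mathbf G)$ is its expansion by a unary function $F$, where $F_{s(\mathbf G)}(x)$ is the set of all $y\in G$ reachable from $x$ by an oriented path, i.e. for which there is a sequence $x=v_1,\dots,v_m=y$ with $m\ge 1$ and $(v_i,v_{i+1})\in E_{\mathbf G}$ for $1\le i<m$. $\mathcal D^k_s=\{s(\mathbf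 G):\mathbf G\in\mathcal D^k\}$. For $\mathbf G\in\mathcal D^k_s$ and $y\in G$, $\mathrm{roots}(y)$ is the set of all roots of $\mathbf G$ lying in $\mathrm{Cl}_{\mathbf G}(y)$. $\mathcal D^k_{s^+}$ is the subclass of those $\mathbf G\in\mathcal D^k_s$ with $\mathrm{roots}(y)\ne\emptyset$ for every $y\in G$. For $\mathbf G\in\mathcal D^k_s$, $d(\mathbf G)$ is the expansion of $\mathbf G$ by an $n$-ary function $F^n$ for every $n\ge 1$, where $F^n_{d(\mathbf G)}(x_1,\dots,x_n)=\{y\in G:\mathrm{roots}(y)=\{x_1,\dots,x_n\}\}$ if $(x_1,\dots,x_n)$ is a tuple of distinct roots, and $F^n_{d(\mathbf G)}(x_1,\dots,x_n)=\emptyset$ otherwise. Finally $\mathcal D^k_d=\{d(\mathbf G):\mathbf G\in\mathcal D^k_{s^+}\}$ (structures with relation $E$ and functions $F$, $F^1,F^2,\dots$). Irreducibility. For substructures $\mathbf B_1,\mathbf B_2$ of $\mathbf C$ with common substructure $\mathbf A$, $\mathbf C$ is the free amalgamation of $\mathbf B_1,\mathbf B_2$ over $\mathbf A$ if $C=B_1\cup B_2$, $B_1\cap B_2=A$, and whenever a tuple $\bar x$ of vertices of $\mathbf C$ contains vertices of both $B_1\setminus A$ and $B_2\setminus A$, then $\bar x$ is in no relation of $\mathbf C$ and every function of the corresponding arity has value $\emptyset$ on $\bar x$. A structure is irreducible if it is not a free amalgamation of two of its proper substructures. EPPA. A partial automorphism of $\mathbf A$ is an isomorphism between substructures of $\mathbf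 A$. A finite $\mathbf B$ is an EPPA-witness for $\mathbf A$ if there is an embedding $\psi\colon\mathbf A\to\mathbf B$ such that every partial automorphism of $\psi(\mathbf A)$ extends to an automorphism of $\mathbf B$. It is coherent if (for this $\psi$) the extensions $f\mapsto\hat f$ can be chosen so that $\widehat{gf}=\hat g\hat f$ whenever $\mathrm{range}(f)=\mathrm{dom}(g)$. It is irreducible structure faithful if (for this $\psi$) for every irreducible substructure $\mathbf C$ of $\mathbf B$ there is an automorphism $g$ of $\mathbf B$ with $g(C)\subseteq\psi(A)$. A class $\mathcal K$ of finite structures has irreducible structure faithful coherent EPPA if every $\mathbf A\in\mathcal K$ has an irreducible structure faithful coherent EPPA-witness $\mathbf B\in\mathcal K$. *)

(* Defs.v *)
From mathcomp Require Import all_boot.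
From mathcomp Require Import boolp.

Set Implicit Arguments.
Unset Strict Implicit.
Unset Printing Implicit Defensive.

Record language := Language {
  rel_sym : Type;
  rel_ar : rel_sym -> nat;
  fun_sym : Type;
  fun_ar : fun_sym -> nat }.

(* All structures are finite, and functions are set-valued. *)
Record structure (L : language) := Structure {
  vert :> finType;
  srel : forall R : rel_sym L, {set (rel_ar R).-tuple vert};
  sfun : forall F : fun_sym L, (fun_ar F).-tuple vert -> {set vert} }.

Arguments srel {L} A R : rename.
Arguments sfun {L} A F x : rename.

Section Maps.
Variable L : language.
Implicit Types A B C : structure L.

Definition embedding A B (f : A -> B) : Prop :=
  [/\ injective f,
      forall R (x : (rel_ar R).-tuple A),
        (x \in srel A R) = (map_tuple f x \in srel B R)
    & forall F (x : (fun_ar F).-tuple A),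
        f @: sfun A F x = sfun B F (map_tuple f x)].

Definition isomorphism A B (f : A -> B) : Prop := bijective f /\ embedding f.

Definition automorphism A (g : A -> A) : Prop := isomorphism g.

(* For an arbitrary set S of vertices, the functions of the induced structure
   are cut down to S; the inclusion is an embedding only if S is closed under
   the functions of A. *)
Definition induced A (S : {set A}) : structure L :=
  @Structure L {x : A | x \in S}
    (fun R => [set x : (rel_ar R).-tuple {x : A | x \in S} |
                map_tuple val x \in srel A R])
    (fun F x => [set y : {x : A | x \in S} |
                  val y \in sfun A F (map_tuple val x)]).

Definition incl A (S : {set A}) (x : induced S) : A := val x.

Definition substructure A (S : {set A}) : Prop := embedding (@incl A S).

Definition Cl A (X : {set A}) : {set A} :=
  [set y | `[< forall S : {set A}, substructure S -> X \subset S -> y \in S >]].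

Definition meets_both A (B1 B2 A0 : {set A}) (x : seq A) : bool :=
  has (mem (B1 :\: A0)) x && has (mem (B2 :\: A0)) x.

Definition free_amalgamation C (B1 B2 A0 : {set C}) : Prop :=
  [/\ [/\ substructure B1, substructure B2 & substructure A0],
      B1 :|: B2 = [set: C],
      B1 :&: B2 = A0,
      forall R (x : (rel_ar R).-tuple C),
        meets_both B1 B2 A0 x -> x \notin srel C R
    & forall F (x : (fun_ar F).-tuple C),
        meets_both B1 B2 A0 x -> sfun C F x = set0].

Definition irreducible C : Prop :=
  ~ exists B1 B2 A0 : {set C},
      [/\ B1 \proper [set: C], B2 \proper [set: C]
        & free_amalgamation B1 B2 A0].

Definition partial_automorphism A (S T : {set A})
    (f : induced S -> induced T) : Prop :=
  [/\ substructure S, substructure T & isomorphism f].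

Definition image_structure A B (psi : A -> B) : structure L :=
  induced (psi @: [set: A]).

Definition extends A B (psi : A -> B) (S T : {set image_structure psi})
    (f : induced S -> induced T) (g : B -> B) : Prop :=
  forall x : induced S, g (incl (incl x)) = incl (incl (f x)).

Definition EPPA_map A B (psi : A -> B) : Prop :=
  embedding psi /\
  forall (S T : {set image_structure psi}) (f : induced S -> induced T),
    partial_automorphism f ->
    exists g : B -> B, automorphism g /\ extends f g.

(* The values of [ext] on maps that are not partial automorphisms are
   irrelevant. *)
Definition coherent_map A B (psi : A -> B) : Prop :=
  exists ext : forall S T : {set image_structure psi},
                 (induced S -> induced T) -> B -> B,
    (forall (S T : {set image_structure psi}) (f : induced S -> induced T),
        partial_automorphism f ->
        automorphism (ext S T f) /\ extends f (ext S T f)) /\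
    (forall (S T U : {set image_structure psi})
        (f : induced S -> induced T) (g : induced T -> induced U),
        partial_automorphism f -> partial_automorphism g ->
        ext S U (g \o f) =1 ext T U g \o ext S T f).

Definition irreducible_faithful_map A B (psi : A -> B) : Prop :=
  forall C : {set B}, substructure C -> irreducible (induced C) ->
    exists g : B -> B, automorphism g /\ g @: C \subset psi @: [set: A].

Definition ISF_coherent_EPPA_witness A B : Prop :=
  exists psi : A -> B,
    [/\ EPPA_map psi, coherent_map psi & irreducible_faithful_map psi].

Definition has_ISF_coherent_EPPA (K : structure L -> Prop) : Prop :=
  forall A, K A -> exists B, K B /\ ISF_coherent_EPPA_witness A B.

End Maps.

(* Languages with a single binary relation E and arbitrary functions. *)
Definition graph_language (Fs : Type) (ar : Fs -> nat) : language :=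
  @Language unit (fun _ => 2) Fs ar.

Definition L_graph : language := @graph_language void (fun _ => 0).

Definition L_s : language := @graph_language unit (fun _ => 1).

(* [Fclosure] is the unary F; [Froots n] is the function F^(n+1). *)
Inductive d_symbol := Fclosure | Froots (n : nat).

Definition d_arity (F : d_symbol) : nat :=
  match F with Fclosure => 1 | Froots n => n.+1 end.

Definition L_d : language := graph_language d_arity.

Section Graphs.
Variables (Fs : Type) (ar : Fs -> nat) (G : structure (graph_language ar)).

Definition edge : rel G :=
  fun u v => [tuple u; v] \in srel G (tt : rel_sym (graph_language ar)).

Definition outdeg (u : G) : nat := #|[set v | edge u v]|.

Definition is_root (k : nat) (u : G) : bool := outdeg u < k.

End Graphs.

Definition oriented (G : structure L_graph) : Prop :=
  forall u v : G, edge u v -> ~~ edge v u.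

Definition D (k : nat) (G : structure L_graph) : Prop :=
  oriented G /\ forall u : G, outdeg u <= k.

Definition s (G : structure L_graph) : structure L_s :=
  @Structure L_s G (srel G) (fun _ x => [set y | connect (@edge _ _ G) (thead x) y]).

Definition D_s (k : nat) (G : structure L_s) : Prop :=
  exists H : structure L_graph, D k H /\ G = s H.

Definition roots (k : nat) (G : structure L_s) (y : G) : {set G} :=
  [set r in Cl [set y] | is_root k r].

Definition D_splus (k : nat) (G : structure L_s) : Prop :=
  D_s k G /\ forall y : G, roots k y != set0.

Definition d_fun (k : nat) (G : structure L_s) (F : d_symbol) :
    (d_arity F).-tuple G -> {set G} :=
  match F with
  | Fclosure => fun x => sfun G (tt : fun_sym L_s) x
  | Froots n => fun x =>
      if uniq x && all (is_root k) x
      then [set y | roots k y == [set r in x]]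
      else set0
  end.

Definition d (k : nat) (G : structure L_s) : structure L_d :=
  @Structure L_d G (srel G) (@d_fun k G).

Definition D_d (k : nat) (A : structure L_d) : Prop :=
  exists G : structure L_s, D_splus k G /\ A = d k G.

(* Main.v *)
Require Import Defs.
From mathcomp Require Import all_boot all_fingroup all_algebra boolp.

(** A d-substructure is a set of vertices that is closed under out-edges and
    contains every vertex whose reachable roots it contains ([dclosed]), and a
    partial automorphism is an isomorphism between the digraphs induced on two
    such sets.  In an irreducible d-structure any two roots are reached
    together from some vertex: otherwise the vertices missing the first root
    and those missing the second are proper substructures, and the structure is
    their free amalgamation ([irreducible_clique]).  So the theorem is about
    finite digraphs ([rooted_orientation_EPPA]); the witness for a digraph A is
    reached in three steps.

    For reachability alone, take all pairs (v, N) where N is a k-orientation on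
    the vertex names of A in which only vertices reachable from v have
    out-edges, with an edge from (v, N) to each out-neighbour w of v, paired
    with what is left of N from w on.  Permutations of the names act on these
    pairs, and A embeds by pairing a with the part of A reachable from a.  If a
    permutation of the names extends an isomorphism f between closed sets, it
    carries the part reachable from a to the part reachable from f a, so its
    action extends f ([pointed_coherent]).

    The image of A is not yet d-closed: a foreign vertex can have all its roots
    in it.  The remedy is a cover ([vcover]) whose vertices carry a valuation
    of their roots, here a charge chi r c for every root r of a vertex c, and
    only those vertices are kept for which each reachable c has total charge 1.
    The roots over A get charges with total 1 at the vertices of A and total 0
    at all others, which excludes the foreign vertices.  To extend a partial
    isomorphism with domain S, its action on the base is combined with a change
    of charges.  This change is prescribed at the roots in S.  If all roots of c
    are in S, then its total at c is 0, precisely because S is d-closed; if not,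
    the other roots of c compensate in equal shares.  Equal shares depend on no
    choice, hence the extensions compose coherently; division by the number of
    roots is why charges lie in a prime field with large p
    ([charge_cover_spec]).

    Finally, a clique of roots that no automorphism moves into A must not
    occur.  In a second cover, every root r of a vertex chooses, for every set
    U containing r that no automorphism moves into A, one of #|U| - 1 seats,
    and roots of the same vertex have different seats.  Roots of a clique then
    have different seats too, so by the pigeonhole principle they cannot
    project onto such a U; whereas A itself can be seated, as it misses a vertex
    of each U.  A clique whose projection is moved into A is moved into the copy
    of A upstairs by permuting the seats ([seat_cover_faithful]).

    Permutations of names and of seats are chosen coherently because there is
    one canonical way to extend a partial injection, matching the two
    complements in the order of their enumerations ([carry_comp]). *)

Set Implicit Arguments.
Unset Strict Implicit.
Unset Printing Implicit Defensive.

(** * Canonical extension of partial injections *)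

Section Carry.
Variables (I T : finType).
Implicit Types (W : {set T}) (S : {set I}) (x y z : I -> T).

(** The partial injection x i |-> y i is encoded by two families indexed by S,
    so that composing partial injections means changing the families.  If
    both families take values in W, then v outside W is fixed: its index is out
    of range in both enumerations, so [nth] returns the default v. *)
Definition carry W S x y (v : T) : T :=
  if [pick i in S | x i == v] is Some i then y i
  else nth v (enum (W :\: y @: S)) (index v (enum (W :\: x @: S))).

Definition inj_into W S x :=
  {in S &, injective x} /\ {in S, forall i, x i \in W}.

Lemma carry_in W S x y i :
  {in S &, injective x} -> i \in S -> carry W S x y (x i) = y i.
Proof.
move=> xI iS; rewrite /carry; case: pickP => [j /andP[jS /eqP /xI <-] //|].
by move/(_ i); rewrite iS eqxx.
Qed.

Lemma carry_out W S x y v : v \notin x @: S ->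
  carry W S x y v = nth v (enum (W :\: y @: S)) (index v (enum (W :\: x @: S))).
Proof.
move=> vx; rewrite /carry; case: pickP => [j /andP[jS /eqP jv]|//].
by case/negP: vx; rewrite -jv imset_f.
Qed.

Lemma size_spare W S x : inj_into W S x ->
  size (enum (W :\: x @: S)) = #|W| - #|S|.
Proof.
case=> xI xW; rewrite -cardE cardsDS ?card_in_imset //.
by apply/subsetP => _ /imsetP[i iS ->]; apply: xW.
Qed.

Lemma carry_outW W S x y v : inj_into W S x -> inj_into W S y ->
  v \notin W -> carry W S x y v = v.
Proof.
move=> xI yI vW; rewrite carry_out; last first.
  by apply: contra vW => /imsetP[i iS ->]; apply: xI.2.
rewrite memNindex ?mem_enum ?inE ?(negbTE vW) ?andbF //.
by rewrite (size_spare xI) -(size_spare yI) nth_default.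
Qed.

Lemma carry_spare W S x y v : inj_into W S x -> inj_into W S y ->
  v \in W :\: x @: S -> carry W S x y v \in W :\: y @: S /\
  index (carry W S x y v) (enum (W :\: y @: S)) =
  index v (enum (W :\: x @: S)).
Proof.
move=> xI yI vx; rewrite carry_out; last by move: vx; rewrite inE => /andP[].
have lt : index v (enum (W :\: x @: S)) < size (enum (W :\: y @: S)).
  by rewrite (size_spare yI) -(size_spare xI) index_mem mem_enum.
by split; [rewrite -mem_enum mem_nth | rewrite index_uniq ?enum_uniq].
Qed.

Lemma carry_sub W S x y v : inj_into W S x -> inj_into W S y ->
  v \in W -> carry W S x y v \in W.
Proof.
move=> xI yI vW; have [/imsetP[i iS ->]|vx] := boolP (v \in x @: S).
  by rewrite (carry_in _ _ xI.1) //; apply: yI.2.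
have [] // := @carry_spare W S x y v xI yI; first by rewrite inE vx.
by rewrite inE => /andP[].
Qed.

(** Coherence: an unused value keeps its position among the unused values. *)
Lemma carry_comp W S x y z v : inj_into W S x -> inj_into W S y ->
  inj_into W S z -> carry W S y z (carry W S x y v) = carry W S x z v.
Proof.
move=> xI yI zI; have [/imsetP[i iS ->]|vx] := boolP (v \in x @: S).
  by rewrite !(carry_in _ _ xI.1) // (carry_in _ _ yI.1).
have [vW|vW] := boolP (v \in W); last by rewrite !carry_outW.
have vs : v \in W :\: x @: S by rewrite inE vx.
have [us ui] := carry_spare xI yI vs.
rewrite [LHS]carry_out; last by move: us; rewrite inE => /andP[].
rewrite ui [RHS]carry_out //; apply: set_nth_default.
by rewrite (size_spare zI) -(size_spare xI) index_mem mem_enum.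
Qed.

Lemma carry_id W S x v : inj_into W S x -> carry W S x x v = v.
Proof.
move=> xI; have [/imsetP[i iS ->]|vx] := boolP (v \in x @: S).
  by rewrite (carry_in _ _ xI.1).
have [vW|vW] := boolP (v \in W); last by rewrite carry_outW.
by rewrite carry_out // nth_index // mem_enum inE vx.
Qed.

Lemma carry_inj W S x y : inj_into W S x -> inj_into W S y ->
  injective (carry W S x y).
Proof.
move=> xI yI; apply: (can_inj (g := carry W S y x)) => v.
by rewrite carry_comp // carry_id.
Qed.

End Carry.

Lemma carry_reindex (I J T : finType) (W : {set T}) (S : {set I}) (f : I -> J)
    (x y : J -> T) (x' y' : I -> T) v :
  {in f @: S &, injective x} -> {in S &, injective x'} ->
  {in S, forall i, x (f i) = x' i} -> {in S, forall i, y (f i) = y' i} ->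
  carry W (f @: S) x y v = carry W S x' y' v.
Proof.
move=> xI xI' ex ey.
have sx : x @: (f @: S) = x' @: S by rewrite -imset_comp; apply: eq_in_imset.
have sy : y @: (f @: S) = y' @: S by rewrite -imset_comp; apply: eq_in_imset.
have [/imsetP[i iS ->]|vx] := boolP (v \in x' @: S).
  by rewrite (carry_in _ _ xI') // -ex // carry_in ?imset_f // ey.
by rewrite !carry_out ?sx // sy.
Qed.

Lemma eq_carry (I T : finType) (W : {set T}) (S : {set I})
    (x y x' y' : I -> T) v :
  {in S &, injective x} -> {in S, x =1 x'} -> {in S, y =1 y'} ->
  carry W S x y v = carry W S x' y' v.
Proof.
move=> xI ex ey; have xI' : {in S &, injective x'}.
  by move=> i j iS jS; rewrite -!ex //; apply: xI.
rewrite -{1}(imset_id S); apply: carry_reindex => //.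
by rewrite imset_id.
Qed.

(** A total constructor lets extensions be defined for all maps f, including
    those that are not partial isomorphisms. *)
Definition mkperm (T : finType) (g : T -> T) : {perm T} :=
  if injectiveP g is ReflectT gI then perm gI else 1%g.

Lemma mkpermE (T : finType) (g : T -> T) x : injective g -> mkperm g x = g x.
Proof. by rewrite /mkperm; case: injectiveP => // gI _; rewrite permE. Qed.

(** * Reachable roots, coverings and partial isomorphisms *)

Section Graphs.
Variable k : nat.

Section OneGraph.
Variables (V : finType) (e : rel V).

Definition outdegree u := #|[set v | e u v]|.

Definition reach u := [set v | connect e u v].

Definition rootset y := [set r in reach y | outdegree r < k].

(** These are the substructures of the associated d-structure. *)
Definition dclosed (S : {set V}) :=
  (forall x y, x \in S -> e x y -> y \in S) /\
  (forall y, rootset y \subset S -> y \in S).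

Definition rooted_orientation :=
  [/\ forall u v, e u v -> ~~ e v u, forall u, outdegree u <= k
    & forall u, rootset u != set0].

Lemma connect_rec (Q : V -> Prop) x y :
  (forall y z, Q y -> e y z -> Q z) -> Q x -> connect e x y -> Q y.
Proof.
move=> QS Qx /connectP[p]; elim: p x Qx => [|z p IH] x Qx /=;
  first by move=> _ ->.
by case/andP=> xz; apply: IH; apply: QS xz.
Qed.

Lemma rootsetP y r :
  reflect (connect e y r /\ outdegree r < k) (r \in rootset y).
Proof. by rewrite !inE; apply: andP. Qed.

Lemma rootset_sub x y : connect e x y -> rootset y \subset rootset x.
Proof.
move=> xy; apply/subsetP=> r /rootsetP[yr ro]; apply/rootsetP.
by split=> //; apply: connect_trans yr.
Qed.

Lemma rootset_edge x y r : e x y -> r \in rootset y -> r \in rootset x.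
Proof. by move=> /connect1/rootset_sub/subsetP; apply. Qed.

Lemma rootset_root y r : r \in rootset y -> r \in rootset r.
Proof. by case/rootsetP=> _ ro; apply/rootsetP. Qed.

Lemma rootset_mono y r : r \in rootset y -> rootset r \subset rootset y.
Proof. by case/rootsetP=> /rootset_sub. Qed.

Lemma dclosed_reach S x y : dclosed S -> x \in S -> connect e x y -> y \in S.
Proof.
move=> [cS _]; apply: (connect_rec (Q := fun z => z \in S)) => a b.
exact: cS.
Qed.

Lemma dclosed_roots S x : dclosed S -> x \in S -> rootset x \subset S.
Proof.
move=> cS xS; apply/subsetP=> r /rootsetP[xr _].
exact: dclosed_reach cS xS xr.
Qed.

End OneGraph.

(** A covering is a bijection between out-neighbourhoods, so it preserves
    everything that is determined by following out-edges: out-degrees,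
    reachable sets, and sets of reachable roots. *)
Definition covering (V W : finType) (e : rel V) (e' : rel W) (h : V -> W) :=
  forall x, {in [set y | e x y] &, injective h} /\
            h @: [set y | e x y] = [set w | e' (h x) w].

Section Covering.
Variables (V W : finType) (e : rel V) (e' : rel W) (h : V -> W).
Hypothesis hC : covering e e' h.

Lemma covering_edge x y : e x y -> e' (h x) (h y).
Proof.
move=> xy; have [_ E] := hC x.
have : h y \in [set w | e' (h x) w] by rewrite -E imset_f // inE.
by rewrite inE.
Qed.

Lemma covering_lift x w : e' (h x) w -> exists2 y, e x y & w = h y.
Proof.
move=> xw; have [_ E] := hC x.
have : w \in [set w | e' (h x) w] by rewrite inE.
by rewrite -E => /imsetP[y]; rewrite inE => xy ->; exists y.
Qed.

Lemma covering_outdegree x : outdegree e' (h x) = outdegree e x.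
Proof. by have [hI E] := hC x; rewrite /outdegree -E card_in_imset. Qed.

Lemma covering_reach x : h @: reach e x = reach e' (h x).
Proof.
apply/setP=> w; apply/imsetP/idP => [[y xy ->]|].
  rewrite inE; rewrite inE in xy.
  apply: (connect_rec (Q := fun y => connect e' (h x) (h y)) _ _ xy) => //.
  by move=> a b xa ab; apply: connect_trans xa (connect1 (covering_edge ab)).
rewrite inE; apply: (connect_rec (Q := fun w =>
  exists2 y, y \in reach e x & w = h y)).
  move=> a b [y xy ->] /covering_lift[z yz ->]; exists z => //.
  by rewrite inE; rewrite inE in xy; apply: connect_trans xy (connect1 yz).
by exists x => //; rewrite inE.
Qed.

Lemma covering_rootset x : h @: rootset e x = rootset e' (h x).
Proof.
apply/setP=> w; rewrite [RHS]inE -covering_reach.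
apply/imsetP/andP => [[y] + -> | [/imsetP[y xy ->]]].
  by rewrite inE => /andP[xy yo]; rewrite imset_f // covering_outdegree.
by rewrite covering_outdegree => yo; exists y => //; rewrite inE xy.
Qed.

Lemma covering_rooted_orientation :
  rooted_orientation e' -> rooted_orientation e.
Proof.
case=> o1 o2 o3; split=> [u v uv|u|u].
- by apply: contra (o1 _ _ (covering_edge uv)) => /covering_edge.
- by rewrite -covering_outdegree.
by have := o3 (h u); rewrite -covering_rootset imset_eq0.
Qed.

End Covering.

Definition graph_auto (V : finType) (e : rel V) (g : {perm V}) :=
  forall x y, e (g x) (g y) = e x y.

Lemma graph_auto_covering (V : finType) (e : rel V) g :
  graph_auto e g -> covering e e g.
Proof.
move=> gA x; split=> [y z _ _ /perm_inj//|].
apply/setP=> w; rewrite inE; apply/imsetP/idP => [[y]|xw].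
  by rewrite inE => xy ->; rewrite gA.
by exists (g^-1 w)%g; rewrite ?permKV // inE -gA permKV.
Qed.

(** The embeddings for reachability alone: the image is closed under
    out-edges.  A [d_embedding] has a d-closed image. *)
Definition s_embedding (A V : finType) (eA : rel A) (e : rel V)
    (psi : A -> V) :=
  [/\ injective psi, forall x y, e (psi x) (psi y) = eA x y
    & forall x w, e (psi x) w -> w \in codom psi].

Definition d_embedding (A V : finType) (eA : rel A) (e : rel V)
    (psi : A -> V) :=
  s_embedding eA e psi /\
  forall w, rootset e w \subset codom psi -> w \in codom psi.

Lemma s_embedding_covering (A V : finType) (eA : rel A) (e : rel V) psi :
  s_embedding eA e psi -> covering eA e psi.
Proof.
case=> pI pE pC x; split=> [y z _ _ /pI//|].
apply/setP=> w; rewrite inE; apply/imsetP/idP => [[y]|xw].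
  by rewrite inE => xy ->; rewrite pE.
case/codomP: (pC _ _ xw) => y wy; exists y => //.
by rewrite inE -pE -wy.
Qed.

Definition partial_iso (A : finType) (eA : rel A) (S : {set A}) (f : A -> A) :=
  [/\ dclosed eA S, dclosed eA (f @: S), {in S &, injective f}
    & {in S &, forall x y, eA (f x) (f y) = eA x y}].

(** Partial isomorphisms are given by a domain S and a map on all of A, which
    avoids maps between subtypes; this is why the last clause is needed. *)
Definition coherent_extension (A V : finType) (eA : rel A) (e : rel V)
    (psi : A -> V) (phi : {set A} -> (A -> A) -> {perm V}) :=
  [/\ forall S f, partial_iso eA S f ->
        graph_auto e (phi S f) /\ {in S, forall x, phi S f (psi x) = psi (f x)},
      forall S f g, partial_iso eA S f -> partial_iso eA (f @: S) g ->
        forall v, phi S (g \o f) v = phi (f @: S) g (phi S f v)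
    & forall S f f', partial_iso eA S f -> {in S, f =1 f'} ->
        phi S f =1 phi S f'].

Lemma coherent_extension_image (A V : finType) (eA : rel A) (e : rel V)
    (psi : A -> V) phi S f :
  coherent_extension eA e psi phi -> partial_iso eA S f ->
  phi S f @: (psi @: S) = psi @: (f @: S).
Proof.
move=> [/(_ S f) phiX _ _] /phiX[_ pX].
by rewrite -!imset_comp; apply: eq_in_imset => a aS /=; apply: pX.
Qed.

Lemma partial_iso_comp (A : finType) (eA : rel A) S f g :
  partial_iso eA S f -> partial_iso eA (f @: S) g -> partial_iso eA S (g \o f).
Proof.
case=> S1 S2 fI fE [_ S3 gI gE]; split=> //.
- by rewrite imset_comp.
- by move=> x y xS yS /gI/fI; rewrite !imset_f //; apply.
by move=> x y xS yS /=; rewrite gE ?imset_f // fE.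
Qed.

End Graphs.

(** * Covers by valuations of the roots *)

Section ValuationCover.
Variables (k : nat) (V : finType) (e : rel V) (Val : finType) (v0 : Val).
Variable P : V -> {ffun V -> Val} -> bool.

(** A vertex of the cover stores values at its own roots only; elsewhere the
    default v0 makes the representation unique. *)
Definition restr (b : V) (chi : {ffun V -> Val}) : {ffun V -> Val} :=
  [ffun r => if r \in rootset k e b then chi r else v0].

Definition vcover_pred (p : V * {ffun V -> Val}) : bool :=
  (p.2 == restr p.1 p.2) && P p.1 p.2.

Definition vcover : finType := {p : V * {ffun V -> Val} | vcover_pred p}.

Definition base (x : vcover) : V := (val x).1.
Definition valuation (x : vcover) : {ffun V -> Val} := (val x).2.

Definition vcover_edge : rel vcover := fun x y =>
  e (base x) (base y) && (valuation y == restr (base y) (valuation x)).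

Lemma vcover_eq x y : base x = base y ->
  {in rootset k e (base x), valuation x =1 valuation y} -> x = y.
Proof.
move=> bE vE; have /andP[/eqP sx _] := valP x; have /andP[/eqP sy _] := valP y.
apply: val_inj; rewrite [val x]surjective_pairing [val y]surjective_pairing.
congr pair => //; rewrite sx sy; apply/ffunP=> r;
  rewrite !ffunE -/(base x) -/(base y) -bE.
by case: ifP => // rx; apply: vE.
Qed.

(** With the next two conditions on P, valuations can be restricted along
    edges, so that forgetting the valuation is a covering. *)
Hypothesis Plocal : forall b (chi chi' : {ffun V -> Val}),
  {in rootset k e b, chi =1 chi'} -> P b chi -> P b chi'.
Hypothesis Phereditary : forall b c chi, e b c -> P b chi -> P c chi.

Lemma valuationP x : P (base x) (valuation x).
Proof. by have /andP[] := valP x. Qed.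

Lemma vcover_exists b chi : P b chi ->
  exists2 x : vcover, base x = b & {in rootset k e b, valuation x =1 chi}.
Proof.
move=> Pb; have rE : {in rootset k e b, restr b chi =1 chi}.
  by move=> r rb; rewrite ffunE rb.
have xP : vcover_pred (b, restr b chi).
  rewrite /vcover_pred /=; apply/andP; split.
    by apply/eqP/ffunP=> r; rewrite !ffunE; case: ifP.
  by apply: Plocal Pb => r rb; rewrite rE.
by exists (Sub (b, restr b chi) xP); rewrite /base /valuation ?SubK.
Qed.

Lemma vcover_edgeP x y : vcover_edge x y <->
  e (base x) (base y) /\ {in rootset k e (base y), valuation y =1 valuation x}.
Proof.
split=> [/andP[xy /eqP yE]|[xy yE]].
  by split=> // r ry; rewrite yE ffunE ry.
rewrite /vcover_edge xy /=; apply/eqP.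
have /andP[/eqP sy _] := valP y.
rewrite {1}/valuation sy -/(base y) -/(valuation y).
by apply/ffunP=> r; rewrite !ffunE; case: ifP => // /yE.
Qed.

Lemma base_covering : covering vcover_edge e base.
Proof.
move=> x; split=> [y z|].
  rewrite !inE => /vcover_edgeP[xy yE] /vcover_edgeP[xz zE] yz.
  by apply: vcover_eq => // r ry; rewrite yE // zE // -yz.
apply/setP=> w; rewrite inE; apply/imsetP/idP => [[y]|xw].
  by rewrite inE => /andP[xy _] ->.
have [y yb yE] := vcover_exists (Phereditary xw (valuationP x)).
by exists y => //; rewrite inE; apply/vcover_edgeP; rewrite yb.
Qed.

Lemma vcover_reachE x y : connect vcover_edge x y ->
  connect e (base x) (base y) /\
  {in rootset k e (base y), valuation y =1 valuation x}.
Proof.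
apply: (connect_rec (Q := fun y => connect e (base x) (base y) /\
  {in rootset k e (base y), valuation y =1 valuation x})) => // a b [xa aE].
move=> /vcover_edgeP[ab bE]; split; first exact: connect_trans xa (connect1 ab).
move=> r rb; rewrite bE // aE //.
exact: rootset_edge ab rb.
Qed.

Lemma vcover_roots x r : r \in rootset k vcover_edge x ->
  base r \in rootset k e (base x).
Proof. by rewrite -(covering_rootset k base_covering) => /imset_f; apply. Qed.

(** The roots of x, as vertices of the cover, remember the whole valuation of
    x; hence a vertex all of whose roots lie in a lifted copy carries the
    valuation of that copy. *)
Lemma vcover_rootsE x r : r \in rootset k vcover_edge x ->
  valuation r (base r) = valuation x (base r).
Proof.
move=> rx; have /rootsetP[/vcover_reachE[_ rE] _] := rx; apply: rE.
by apply: rootset_root (vcover_roots rx).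
Qed.

Lemma vcover_root_lift x r : r \in rootset k e (base x) ->
  exists2 r', r' \in rootset k vcover_edge x & base r' = r.
Proof.
by rewrite -(covering_rootset k base_covering) => /imsetP[r' ? ->]; exists r'.
Qed.

Lemma vcover_rooted_orientation :
  rooted_orientation k e -> rooted_orientation k vcover_edge.
Proof. exact: covering_rooted_orientation base_covering. Qed.

(** An automorphism phi of the base, together with a permutation of the
    values at each root, acts on the cover.  [insubd] makes the definition
    total; the result satisfies the predicate of the cover when the pair is
    [twistable]. *)
Definition twist (phi : {perm V}) (tau : V -> Val ->
  Val) (x : vcover) : vcover :=
  insubd x (phi (base x),
    restr (phi (base x))
      [ffun r => tau ((phi^-1)%g r) (valuation x ((phi^-1)%g r))]).

Definition twistable phi (tau : V -> Val -> Val) :=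
  [/\ graph_auto e phi, forall r, injective (tau r)
    & forall b (chi chi' : {ffun V -> Val}), P b chi ->
        {in rootset k e b, forall r, chi' (phi r) = tau r (chi r)} ->
        P (phi b) chi'].

Section Twist.
Variables (phi : {perm V}) (tau : V -> Val -> Val).
Hypothesis tw : twistable phi tau.

Lemma mem_auto_rootset b r :
  (phi r \in rootset k e (phi b)) = (r \in rootset k e b).
Proof.
have [phiA _ _] := tw.
by rewrite -(covering_rootset k (graph_auto_covering phiA)) mem_imset //;
  apply: perm_inj.
Qed.

Lemma twist_spec x : base (twist phi tau x) = phi (base x) /\
  {in rootset k e (base x), forall r,
     valuation (twist phi tau x) (phi r) = tau r (valuation x r)}.
Proof.
have [phiA tauI tauP] := tw.
set chi := restr (phi (base x))
  [ffun r => tau ((phi^-1)%g r) (valuation x ((phi^-1)%g r))].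
have chiE : {in rootset k e (base x), forall r, chi (phi r) = tau r (valuation
  x r)}.
  by move=> r rx; rewrite !ffunE mem_auto_rootset rx permK.
have xP : vcover_pred (phi (base x), chi).
  rewrite /vcover_pred /= (tauP _ _ _ (valuationP x) chiE) andbT.
  by apply/eqP/ffunP=> r; rewrite !ffunE; case: ifP.
by rewrite /base /valuation /twist !insubdK.
Qed.

Lemma twist_inj : injective (twist phi tau).
Proof.
move=> x y xy; have [bx vx] := twist_spec x; have [by_ vy] := twist_spec y.
have [_ tauI _] := tw.
have bE : base x = base y by apply: (@perm_inj _ phi); rewrite -bx -by_ xy.
apply: vcover_eq => // r rx; apply: (tauI r); rewrite -vx //.
by rewrite -vy -?bE // xy.
Qed.

Lemma twist_edge x y :
  vcover_edge (twist phi tau x) (twist phi tau y) = vcover_edge x y.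
Proof.
have [bx vx] := twist_spec x; have [by_ vy] := twist_spec y.
have [phiA tauI _] := tw.
apply/idP/idP => /vcover_edgeP[xy yE]; apply/vcover_edgeP; move: xy yE.
  rewrite bx by_ phiA => xy yE; split=> // r ry; apply: (tauI r).
  have rx : r \in rootset k e (base x) := rootset_edge xy ry.
  by rewrite -vy // -vx // yE // mem_auto_rootset.
rewrite bx by_ phiA => xy yE; split=> // r;
  rewrite -(permKV phi r) mem_auto_rootset => ry.
have rx := rootset_edge xy ry.
by rewrite vx // vy // yE.
Qed.

Lemma twist_auto : graph_auto vcover_edge (mkperm (twist phi tau)).
Proof. by move=> x y; rewrite !mkpermE; [apply: twist_edge | apply:
  twist_inj..]. Qed.

End Twist.

Section CoherentCover.
Variables (A : finType) (eA : rel A) (psi : A -> V).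
Variable phi : {set A} -> (A -> A) -> {perm V}.
Variable X : {ffun V -> Val}.
Variable tau : {set A} -> (A -> A) -> V -> Val -> Val.

Hypothesis psiE : s_embedding eA e psi.
Hypothesis phiE : coherent_extension k eA e psi phi.
Hypothesis PX : forall a, P (psi a) X.
Hypothesis tau_twist : forall S f, partial_iso k eA S f ->
  twistable (phi S f) (tau S f).
Hypothesis tau_extends : forall S f, partial_iso k eA S f ->
  {in S, forall a, tau S f (psi a) (X (psi a)) = X (psi (f a))}.
Hypothesis tau_comp : forall S f g,
  partial_iso k eA S f -> partial_iso k eA (f @: S) g ->
  forall r v, tau S (g \o f) r v = tau (f @: S) g (phi S f r) (tau S f r v).
Hypothesis tau_congr : forall S f f', partial_iso k eA S f -> {in S, f =1 f'} ->
  forall r v, tau S f r v = tau S f' r v.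

Fact section_subproof a : vcover_pred (psi a, restr (psi a) X).
Proof.
rewrite /vcover_pred /=; apply/andP; split.
  by apply/eqP/ffunP=> r; rewrite !ffunE; case: ifP.
by apply: Plocal (PX a) => r rb; rewrite ffunE rb.
Qed.

(** One valuation X of all vertices, restricted to the roots of each vertex,
    lifts an embedding to the cover. *)
Definition vsection a : vcover := Sub (psi a, restr (psi a) X)
  (section_subproof a).

Lemma base_section a : base (vsection a) = psi a.
Proof. by rewrite /base SubK. Qed.

Lemma valuation_section a : {in rootset k e (psi a), valuation (vsection a) =1
  X}.
Proof. by move=> r ra; rewrite /valuation SubK ffunE ra. Qed.

Lemma vsectionP x : base x \in codom psi ->
  {in rootset k e (base x), valuation x =1 X} -> x \in codom vsection.
Proof.
case/codomP=> a xa xX; apply/codomP; exists a.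
apply: vcover_eq; rewrite ?base_section // => r rx.
by rewrite xX // valuation_section // -xa.
Qed.

Lemma vsection_s_embedding : s_embedding eA vcover_edge vsection.
Proof.
have [pI pE pC] := psiE; split=> [a b|a b|a w].
- by move/(congr1 base); rewrite !base_section => /pI.
- apply/idP/idP => [/andP[]|ab]; first by rewrite !base_section pE.
  apply/vcover_edgeP; rewrite !base_section pE; split=> // r rb.
  by rewrite !valuation_section //; apply: rootset_edge rb; rewrite pE.
case/vcover_edgeP; rewrite base_section => aw wE; apply: vsectionP;
  first exact: pC aw.
move=> r rw; rewrite wE // valuation_section //.
exact: rootset_edge aw rw.
Qed.

(** If all roots of w lie in the lifted copy, then w carries the valuation X,
    so P holds for X at the base of w. *)
Lemma vsection_d_embedding :
  (forall c, rootset k e c \subset codom psi -> P c X -> c \in codom psi) ->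
  d_embedding k eA vcover_edge vsection.
Proof.
move=> cX; split; first exact: vsection_s_embedding.
move=> w /subsetP ws.
have wr r : r \in rootset k e (base w) -> r \in codom psi /\ valuation w r = X
  r.
  move=> /vcover_root_lift[r' rw <-]; have /codomP[a r'a] := ws _ rw.
  rewrite -(vcover_rootsE rw); split; first by rewrite r'a base_section codom_f.
  rewrite {1}r'a valuation_section // r'a base_section -base_section -r'a.
  exact: rootset_root (vcover_roots rw).
apply: vsectionP; last by move=> r /wr[].
apply: cX; first by apply/subsetP=> r /wr[].
by apply: Plocal (valuationP w) => r /wr[].
Qed.

Lemma twist_extends S f : partial_iso k eA S f ->
  {in S, forall a, twist (phi S f) (tau S f) (vsection a) = vsection (f a)}.
Proof.
move=> pf a aS; have [/(_ _ _ pf)[phiA phiX] _ _] := phiE.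
have tw := tau_twist pf; have [tb tv] := twist_spec tw (vsection a).
have [cS _ _ _] := pf; have [_ _ pC] := psiE.
apply: vcover_eq; rewrite tb base_section phiX ?base_section // => r.
rewrite -[r](permKV (phi S f)) -phiX // (mem_auto_rootset tw).
set q := ((phi S f)^-1)%g r => qa.
rewrite tv ?base_section // valuation_section //.
have := qa; rewrite -(covering_rootset k (s_embedding_covering psiE)).
case/imsetP=> c ca qc; have cS' := subsetP (dclosed_roots cS aS) c ca.
rewrite qc tau_extends // -?phiX // valuation_section //.
by rewrite -phiX // (mem_auto_rootset tw) -qc.
Qed.

(** A coherent extension procedure on the base lifts as soon as the value
    permutations tau are themselves coherent, since a vertex of the cover is
    given by its base and its values at the roots. *)
Lemma vsection_coherent :
  coherent_extension k eA vcover_edge vsection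
    (fun S f => mkperm (twist (phi S f) (tau S f))).
Proof.
have [phi1 phi2 phi3] := phiE.
split=> [S f pf|S f g pf pg x|S f f' pf ff' x].
- have tw := tau_twist pf; split; first exact: twist_auto.
  by move=> a aS; rewrite mkpermE ?twist_extends //; apply: twist_inj.
- have pgf := partial_iso_comp pf pg.
  have twf := tau_twist pf; have twg := tau_twist pg.
  have twgf := tau_twist pgf.
  rewrite (mkpermE _ (twist_inj twf)) (mkpermE _ (twist_inj twg)).
  rewrite (mkpermE _ (twist_inj twgf)).
  set y := twist (phi S f) (tau S f) x.
  have [b1 v1] := twist_spec twf x; have [b2 v2] := twist_spec twg y.
  have [b3 v3] := twist_spec twgf x; rewrite -/y in b1 v1.
  have phiC := phi2 _ _ _ pf pg.
  apply: vcover_eq; first by rewrite b3 b2 b1 phiC.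
  move=> r; rewrite b3 -[r](permKV (phi S (g \o f))) (mem_auto_rootset twgf).
  set q := ((phi S (g \o f))^-1)%g r => rx.
  rewrite (v3 q rx) phiC v2 ?b1 ?(mem_auto_rootset twf) // v1 //.
  exact: tau_comp.
have pf' : partial_iso k eA S f'.
  have [S1 S2 fI fE] := pf; split=> //.
  - by rewrite -(eq_in_imset ff').
  - by move=> a b aS bS; rewrite -!ff' //; apply: fI.
  by move=> a b aS bS; rewrite -!ff' //; apply: fE.
have tw := tau_twist pf; have tw' := tau_twist pf'.
rewrite (mkpermE _ (twist_inj tw)) (mkpermE _ (twist_inj tw')).
have [b1 v1] := twist_spec tw x; have [b2 v2] := twist_spec tw' x.
have phiC := phi3 _ _ _ pf ff'.
apply: vcover_eq; first by rewrite b1 b2 phiC.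
move=> r; rewrite b1 -[r](permKV (phi S f)) (mem_auto_rootset tw).
set q := ((phi S f)^-1)%g r => rx.
by rewrite (v1 q rx) phiC v2 //; apply: tau_congr.
Qed.

End CoherentCover.

End ValuationCover.

(** * Closures of single vertices *)

Section PointedOrientations.
Variables (k : nat) (A : finType).
Hypothesis k_gt0 : 0 < k.
Implicit Types (N : {ffun A -> {set A}}) (p : {perm A}).

Definition out_rel N : rel A := fun x y => y \in N x.

(** The part of N that is visible from w. *)
Definition cut N w : {ffun A -> {set A}} :=
  [ffun x => if connect (out_rel N) w x then N x else set0].

Lemma sub_cut N w x y : out_rel (cut N w) x y -> out_rel N x y.
Proof. by rewrite /out_rel ffunE; case: ifP => //; rewrite inE. Qed.

Lemma connect_cut N w x y : connect (out_rel N) w x ->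
  connect (out_rel (cut N w)) x y = connect (out_rel N) x y.
Proof.
move=> wx; apply/idP/idP.
  by apply: connect_sub => a b /sub_cut/connect1.
move=> xy; suff [] : connect (out_rel N) w y /\ connect (out_rel (cut N w)) x
  y by [].
move: xy; apply: (connect_rec (Q := fun y => connect (out_rel N) w y /\
  connect (out_rel (cut N w)) x y)) => // a b [wa xa] ab.
split; first exact: connect_trans wa (connect1 ab).
by apply: connect_trans xa (connect1 _); rewrite /out_rel ffunE wa.
Qed.

Lemma cut_cut N w x : connect (out_rel N) w x -> cut (cut N w) x = cut N x.
Proof.
move=> wx; apply/ffunP=> y; rewrite !ffunE connect_cut //.
by case: ifP => // xy; rewrite (connect_trans wx xy).
Qed.

Lemma outdegree_out_rel N x : outdegree (out_rel N) x = #|N x|.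
Proof. by apply: eq_card => y; rewrite inE. Qed.

Lemma cut_rooted N w : rooted_orientation k (out_rel N) ->
  rooted_orientation k (out_rel (cut N w)).
Proof.
case=> N1 N2 N3; split=> [u v /sub_cut uv|u|u].
- by apply: contra (N1 _ _ uv) => /sub_cut.
- rewrite outdegree_out_rel ffunE; case: ifP; rewrite ?cards0 //.
  by rewrite -outdegree_out_rel.
have [wu|wu] := boolP (connect (out_rel N) w u).
  have /set0Pn[r /rootsetP[ur ro]] := N3 u; apply/set0Pn; exists r.
  apply/rootsetP; rewrite connect_cut // outdegree_out_rel ffunE.
  by rewrite (connect_trans wu ur) -outdegree_out_rel.
apply/set0Pn; exists u; apply/rootsetP; split=> //.
by rewrite outdegree_out_rel ffunE (negbTE wu) cards0.
Qed.

(** A pair (v, N) is an abstract copy of the closure of a single vertex v. *)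
Definition pointed_pred (x : A * {ffun A -> {set A}}) :=
  `[< rooted_orientation k (out_rel x.2) >] && (cut x.2 x.1 == x.2).

Definition pointed : finType :=
  {x : A * {ffun A -> {set A}} | pointed_pred x}.

Definition pointed_edge : rel pointed := fun x y =>
  out_rel (val x).2 (val x).1 (val y).1 && ((val y).2 == cut (val x).2 (val
    y).1).

Fact point_subproof N (gN : rooted_orientation k (out_rel N)) w :
  pointed_pred (w, cut N w).
Proof.
rewrite /pointed_pred /= cut_cut // eqxx andbT.
by apply/asboolP/cut_rooted.
Qed.

Definition point N (gN : rooted_orientation k (out_rel N)) w : pointed :=
  Sub (w, cut N w) (point_subproof gN w).

Lemma val_point N (gN : rooted_orientation k (out_rel N)) w :
  val (point gN w) = (w, cut N w).
Proof. by []. Qed.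

Lemma pointP (x : pointed) : exists N (gN : rooted_orientation k (out_rel N)) v,
  x = point gN v.
Proof.
have /andP[/asboolP gN /eqP cN] := valP x.
exists (val x).2, gN, (val x).1; apply: val_inj.
by rewrite SubK cN -surjective_pairing.
Qed.

(** Each orientation N on the names gives an embedded copy of N, and these
    copies exhaust the structure ([pointP]); hence out-degrees and roots of
    [pointed] can be computed inside them. *)
Lemma point_s_embedding N (gN : rooted_orientation k (out_rel N)) :
  s_embedding (out_rel N) pointed_edge (point gN).
Proof.
split=> [x y|x y|x w].
- by move/(congr1 (fun z : pointed => (val z).1)).
- rewrite /pointed_edge !val_point /= {1}/out_rel ffunE connect0.
  rewrite -[y \in N x]/(out_rel N x y); case: (boolP (out_rel N x y)) => //= xy.
  by rewrite cut_cut ?eqxx // connect1.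
rewrite /pointed_edge val_point /= {1}/out_rel ffunE connect0 =>
  /andP[xw /eqP wE].
apply/codomP; exists (val w).1; apply: val_inj.
by rewrite SubK [LHS]surjective_pairing wE cut_cut // connect1.
Qed.

Lemma pointed_rooted : rooted_orientation k pointed_edge.
Proof.
split=> u; have [N [gN [a ->]]] := pointP u; have pN := point_s_embedding gN.
- have [N1 _ _] := gN; have [_ pE pC] := pN.
  by move=> v uv; have /codomP[b vb] := pC _ _ uv; move: uv;
    rewrite vb !pE => /N1.
- by rewrite (covering_outdegree (s_embedding_covering pN));
  have [_ N2 _] := gN.
rewrite -(covering_rootset k (s_embedding_covering pN)) imset_eq0.
by have [_ _ N3] := gN.
Qed.

Definition act p N : {ffun A -> {set A}} := [ffun x => p @: N ((p^-1)%g x)].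

Lemma act_covering p N : covering (out_rel (act p N)) (out_rel N) (p^-1)%g.
Proof.
move=> x; split=> [y z _ _ /perm_inj//|].
apply/setP=> w; rewrite inE; apply/imsetP/idP=> [[y]|xw].
  by rewrite inE /out_rel ffunE => /imsetP[z zN ->] ->; rewrite permK.
by exists (p w); rewrite ?permK // inE /out_rel ffunE imset_f.
Qed.

Lemma connect_act p N x y :
  connect (out_rel (act p N)) (p x) (p y) = connect (out_rel N) x y.
Proof.
have := covering_reach (act_covering p N) (p x); rewrite permK => /setP/(_ y).
rewrite inE => <-; rewrite -[y in RHS](permK p) mem_imset ?inE //.
exact: perm_inj.
Qed.

Lemma act_cut p N x : cut (act p N) (p x) = act p (cut N x).
Proof.
apply/ffunP=> y; rewrite -(permKV p y) !ffunE connect_act permK.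
by case: ifP; rewrite ?imset0.
Qed.

Lemma act_rooted p N : rooted_orientation k (out_rel N) ->
  rooted_orientation k (out_rel (act p N)).
Proof. exact: covering_rooted_orientation (act_covering p N). Qed.

Definition rename p (x : pointed) : pointed :=
  insubd x (p (val x).1, act p (val x).2).

Lemma val_rename p x : val (rename p x) = (p (val x).1, act p (val x).2).
Proof.
rewrite /rename insubdK //; have /andP[/asboolP gN /eqP cN] := valP x.
apply/andP; rewrite /= act_cut cN; split=> //.
by apply/asboolP/act_rooted.
Qed.

Lemma act_comp p q N : act q (act p N) = act (p * q) N.
Proof.
apply/ffunP=> x; rewrite !ffunE -imset_comp invMg permM.
by apply: eq_imset => y /=; rewrite permM.
Qed.

Lemma act_inj p : injective (act p).
Proof.
apply: (can_inj (g := act p^-1)) => N; rewrite act_comp mulgV.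
apply/ffunP=> x; rewrite ffunE invg1 perm1 -[RHS]imset_id.
by apply: eq_imset => y; rewrite perm1.
Qed.

Lemma rename_inj p : injective (rename p).
Proof.
move=> x y /(congr1 val); rewrite !val_rename => -[/perm_inj xy /act_inj Nxy].
by apply: val_inj; rewrite [LHS]surjective_pairing xy Nxy -surjective_pairing.
Qed.

Lemma rename_edge p x y : pointed_edge (rename p x) (rename p y) =
  pointed_edge x y.
Proof.
rewrite /pointed_edge !val_rename /= act_cut (inj_eq (@act_inj p)).
by rewrite /out_rel ffunE permK mem_imset //; apply: perm_inj.
Qed.

Variable eA : rel A.

Definition out_sets : {ffun A -> {set A}} := [ffun x => [set y | eA x y]].

Lemma out_relE : out_rel out_sets =2 eA.
Proof. by move=> x y; rewrite /out_rel ffunE inE. Qed.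

Definition extend_perm (S : {set A}) (f : A -> A) : {perm A} :=
  mkperm (carry [set: A] S id f).

Lemma inj_intoT (S : {set A}) (f : A -> A) :
  {in S &, injective f} -> inj_into [set: A] S f.
Proof. by split=> // i; rewrite inE. Qed.

Lemma extend_permE (S : {set A}) f : {in S &, injective f} ->
  extend_perm S f =1 carry [set: A] S id f.
Proof.
by move=> fI x; apply/mkpermE/carry_inj; apply: inj_intoT => // a b _ _.
Qed.

Lemma extend_perm_in (S : {set A}) f : {in S &, injective f} ->
  {in S, extend_perm S f =1 f}.
Proof.
by move=> fI x xS; rewrite extend_permE // (@carry_in _ _ _ _ id) // => a b _ _.
Qed.

Lemma extend_perm_comp (S : {set A}) f g : {in S &, injective f} ->
  {in f @: S &, injective g} ->
  extend_perm S (g \o f) = (extend_perm S f * extend_perm (f @: S) g)%g.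
Proof.
move=> fI gI; have gfI : {in S &, injective (g \o f)}.
  by move=> x y xS yS /gI/fI; rewrite !imset_f //; apply.
have idI (U : {set A}) : {in U &, injective (@id A)} by move=> x y.
apply/permP=> x; rewrite permM !extend_permE //.
rewrite (@carry_reindex _ _ _ _ _ f id g f (g \o f)) //.
by rewrite carry_comp //; apply: inj_intoT.
Qed.

(** Renaming by an extension of f matches the closure of a with the closure of
    f a, because both S and its image contain everything reachable from
    them, and f is an isomorphism there. *)
Lemma act_extend_perm S f a : partial_iso k eA S f -> a \in S ->
  act (extend_perm S f) (cut out_sets a) = cut out_sets (f a).
Proof.
move=> [[S1 _] [S2 _] fI fE] aS; set p := extend_perm S f.
have pf : {in S, p =1 f} := extend_perm_in fI.
have reachE y : connect (out_rel out_sets) (f a) (p y) =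
                connect (out_rel out_sets) a y.
  rewrite !(eq_connect out_relE); apply/idP/idP => [ay|].
    suff [z [zS /perm_inj ->]] : exists z, [/\ z \in S, p y = p z & connect eA
      a z] by [].
    move: ay; apply: (connect_rec (Q := fun w =>
      exists z, [/\ z \in S, w = p z & connect eA a z])); last by exists a;
        rewrite pf.
    move=> _ c [z [zS -> az]]; rewrite pf // => zc.
    have /imsetP[b bS cb] := S2 _ _ (imset_f f zS) zc.
    exists b; rewrite pf //; split=> //; apply: connect_trans az (connect1 _).
    by rewrite -fE // -cb.
  move=> ay; suff [yS] : y \in S /\ connect eA (f a) (f y) by rewrite pf.
  move: ay; apply: (connect_rec (Q := fun y =>
    y \in S /\ connect eA (f a) (f y))) => //.
  move=> b c [bS ab] bc; have cS := S1 _ _ bS bc.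
  by split=> //; apply: connect_trans ab (connect1 _); rewrite fE.
apply/ffunP=> x; rewrite -(permKV p x); set y := (p^-1)%g x.
rewrite !ffunE permK reachE (eq_connect out_relE).
case: ifP => [ay|_]; last by rewrite imset0.
have yS : y \in S.
  by move: ay; apply: (connect_rec (Q := fun y => y \in S)) => // b c;
    apply: S1.
apply/setP=> w; rewrite inE pf //; apply/imsetP/idP => [[z]|yw].
  by rewrite inE => yz ->; rewrite pf ?(S1 _ _ yS) // fE // (S1 _ _ yS).
have /imsetP[b bS wb] := S2 _ _ (imset_f f yS) yw.
by exists b; rewrite ?pf // inE -fE // -wb.
Qed.

Lemma pointed_coherent : rooted_orientation k eA ->
  exists psi : A -> pointed, s_embedding eA pointed_edge psi /\
    coherent_extension k eA pointed_edge psi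
      (fun S f => mkperm (rename (extend_perm S f))).
Proof.
move=> gA; have gN : rooted_orientation k (out_rel out_sets).
  apply: (covering_rooted_orientation (h := id)) gA => x; split;
    first by move=> y z.
  by rewrite imset_id; apply/setP=> y; rewrite !inE out_relE.
exists (point gN); split.
  by have [p1 p2 p3] := point_s_embedding gN; split=> // x y;
    rewrite p2 out_relE.
split=> [S f pf|S f g pf pg v|S f f' pf ff' v].
- split=> [x y|a aS]; first by rewrite !mkpermE ?rename_edge //;
  apply: rename_inj.
  rewrite mkpermE; last exact: rename_inj.
  apply: val_inj; rewrite val_rename /= act_extend_perm //.
  by rewrite extend_perm_in //; case: pf.
- rewrite !(mkpermE _ (@rename_inj _)) extend_perm_comp;
  try by case: pf pg => [_ _ ? _] [].
  by apply: val_inj; rewrite !val_rename /= act_comp permM.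
have [_ _ fI _] := pf; have fI' : {in S &, injective f'}.
  by move=> x y xS yS; rewrite -!ff' //; apply: fI.
suff -> : extend_perm S f = extend_perm S f' by [].
apply/permP=> x; rewrite !extend_permE //; apply: eq_carry => //.
Qed.

End PointedOrientations.

(** * Charges: making the embedding d-closed *)

Section ChargeCover.
Import GRing.Theory.
Local Open Scope ring_scope.

Variables (k : nat) (A V : finType) (eA : rel A) (e : rel V) (psi : A -> V).
Variable phi : {set A} -> (A -> A) -> {perm V}.
Hypothesis eG : rooted_orientation k e.
Hypothesis psiE : s_embedding eA e psi.
Hypothesis phiE : coherent_extension k eA e psi phi.

Variable p : nat.
Hypothesis p_prime : prime p.
Hypothesis p_large : (#|V| < p)%N.
Let K := 'F_p.

(** The purpose of a prime above #|V|: numbers of roots are invertible. *)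
Lemma natr_card_neq0 n : (0 < n <= #|V|)%N -> n%:R != 0 :> K.
Proof.
case/andP=> n0 nV; rewrite -(dvdn_pcharf (pchar_Fp p_prime)) gtnNdvd //.
exact: leq_ltn_trans nV p_large.
Qed.

Definition charged (b : V) (chi : {ffun V -> {ffun V -> K}}) : bool :=
  [forall c, connect e b c ==> (\sum_(r in rootset k e c) chi r c == 1)].

(** Dividing a total charge of 1 equally among the roots of c makes the
    prescribed charge independent of the root. *)
Definition share (c : V) : K :=
  if c \in codom psi then (#|rootset k e c|%:R)^-1 else 0.

Definition shares : {ffun V -> {ffun V -> K}} :=
  [ffun r => [ffun c => share c]].

Lemma charged_local b (chi chi' : {ffun V -> {ffun V -> K}}) :
  {in rootset k e b, chi =1 chi'} -> charged b chi -> charged b chi'.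
Proof.
move=> E /forallP cb; apply/forallP=> c; apply/implyP=> bc.
rewrite -(eqP (implyP (cb c) bc)); apply/eqP/eq_bigr => r rc.
by rewrite E // (subsetP (rootset_sub k bc)).
Qed.

Lemma charged_hereditary b c chi : e b c -> charged b chi -> charged c chi.
Proof.
move=> bc /forallP cb; apply/forallP=> x; apply/implyP=> cx.
by apply: (implyP (cb x)); apply: connect_trans cx; apply: connect1.
Qed.

Lemma sum_shares c : \sum_(r in rootset k e c) shares r c = (c \in codom
  psi)%:R.
Proof.
rewrite (eq_bigr (fun=> share c)); last by move=> r _; rewrite !ffunE.
rewrite sumr_const /share; case: ifP => _; last by rewrite mul0rn.
rewrite -[_ *+ _]mulr_natr mulVf // natr_card_neq0 // max_card andbT card_gt0.
by have [_ _] := eG.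
Qed.

Lemma shares_charged a : charged (psi a) shares.
Proof.
apply/forallP=> c; apply/implyP=> ac; rewrite sum_shares; apply/eqP.
have [_ _ pC] := psiE; suff -> : c \in codom psi by [].
move: ac; apply: (connect_rec (Q := fun c => c \in codom psi)).
  by move=> y z /codomP[b ->]; apply: pC.
exact: codom_f.
Qed.

Section Shift.
Variables (g : {perm V}) (S : {set V}).

Definition excess (c : V) : K := share (g c) - share c.

(** What has to be added to the charges so that the shares at c become the
    shares at g c on the roots in S, the other roots of c compensating
    equally. *)
Definition correction (r c : V) : K :=
  if r \in S then excess c
  else - (excess c * #|rootset k e c :&: S|%:R / #|rootset k e c :\: S|%:R).

Definition shift (r : V) (v : {ffun V -> K}) : {ffun V -> K} :=
  [ffun c => v ((g^-1)%g c) + correction r ((g^-1)%g c)].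

Lemma shiftE r v c : shift r v (g c) = v c + correction r c.
Proof. by rewrite ffunE permK. Qed.

Lemma shift_inj r : injective (shift r).
Proof.
move=> v w vw; apply/ffunP=> c; apply: (addIr (correction r c)).
by rewrite -!shiftE vw.
Qed.

Lemma sum_correction c : (rootset k e c \subset S -> excess c = 0) ->
  \sum_(r in rootset k e c) correction r c = 0.
Proof.
move=> ex; rewrite (big_setID S) /=.
rewrite (eq_bigr (fun=> excess c)); last first.
  by move=> r; rewrite inE /correction => /andP[_ ->].
rewrite [X in _ + X](eq_bigr (fun=>
    - (excess c * #|rootset k e c :&: S|%:R / #|rootset k e c :\: S|%:R)));
      last first.
  by move=> r; rewrite inE /correction => /andP[/negbTE-> _].
rewrite !sumr_const -(mulr_natr (excess c)) -(mulr_natr (- _)).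
have [/eqP|n0] := posnP #|rootset k e c :\: S|.
  by rewrite cards_eq0 setD_eq0 => /ex ->; rewrite !mul0r oppr0 mul0r addr0.
by rewrite mulNr divfK ?subrr // natr_card_neq0 // n0 max_card.
Qed.

End Shift.

(** This is where d-closedness of S and of its image enters: c belongs to the
    copy of A exactly when its image does, provided the roots of c are in the
    copy of S. *)
Lemma excess_closed S f c : partial_iso k eA S f ->
  rootset k e c \subset psi @: S -> excess (phi S f) c = 0.
Proof.
move=> pf cS; have [/(_ _ _ pf)[gA pX] _ _] := phiE.
have [pI pE pC] := psiE; have [S1 S2 _ _] := pf; set g := phi S f in gA pX *.
have rC := covering_rootset k (s_embedding_covering psiE).
have rA := covering_rootset k (graph_auto_covering gA).
have mem_closed (T : {set A}) a : dclosed k eA T ->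
  rootset k e (psi a) \subset psi @: T -> a \in T.
  move=> [_ cT] aT; apply: cT; apply/subsetP=> r ra.
  by rewrite -(mem_imset _ _ pI) (subsetP aT) // -rC imset_f.
apply/eqP; rewrite subr_eq0 /share -rA card_imset; last exact: perm_inj.
suff -> : (g c \in codom psi) = (c \in codom psi) by [].
apply/codomP/codomP => [[b gcb]|[a ca]]; last first.
  exists (f a); rewrite ca pX //; apply: (mem_closed S) => //.
  by rewrite -ca.
have : b \in f @: S.
  apply: mem_closed => //; rewrite -gcb -rA -(coherent_extension_image phiE) //.
  exact: imsetS.
case/imsetP=> a aS ba; exists a; apply: (@perm_inj _ g).
by rewrite gcb ba pX.
Qed.

Definition charge_twist (S : {set A}) (f : A -> A) : V -> {ffun V -> K} ->
  {ffun V -> K} :=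
  shift (phi S f) (psi @: S).

Lemma charge_twistable S f : partial_iso k eA S f ->
  twistable k e charged (phi S f) (charge_twist S f).
Proof.
move=> pf; have [/(_ _ _ pf)[gA pX] _ _] := phiE.
split=> // [|b chi chi' /forallP cb chiE]; first exact: shift_inj.
apply/forallP=> c; apply/implyP; set g := phi S f in gA pX chiE *.
rewrite -(permKV g c); set c' := (g^-1)%g c => bc.
have {}bc : connect e b c'.
  have := covering_reach (graph_auto_covering gA) b => /setP/(_ (g c')).
  by rewrite mem_imset ?inE ?bc //; apply: perm_inj.
rewrite -(covering_rootset k (graph_auto_covering gA)).
rewrite big_imset /=; last by move=> x y _ _; apply: perm_inj.
rewrite (eq_bigr (fun r => chi r c' + correction g (psi @: S) r c')).
  rewrite big_split /= (eqP (implyP (cb c') bc)) sum_correction ?addr0 //.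
  exact: excess_closed.
by move=> r rc; rewrite chiE ?shiftE // (subsetP (rootset_sub k bc)).
Qed.

Lemma charge_twist_extends S f : partial_iso k eA S f ->
  {in S, forall a, charge_twist S f (psi a) (shares (psi a)) = shares (psi (f
    a))}.
Proof.
move=> pf a aS; apply/ffunP=> c; rewrite -(permKV (phi S f) c) shiftE !ffunE.
by rewrite /correction imset_f // /excess addrC subrK.
Qed.

(** The excess is a difference of shares, so it telescopes, and the
    compensation is linear in it. *)
Lemma charge_twist_comp S f g :
  partial_iso k eA S f -> partial_iso k eA (f @: S) g -> forall r v,
  charge_twist S (g \o f) r v = charge_twist (f @: S) g (phi S f r)
    (charge_twist S f r v).
Proof.
move=> pf pg r v; have [/(_ _ _ pf)[gA pX] phiC _] := phiE.
have {}phiC := phiC _ _ _ pf pg.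
apply/ffunP=> c; rewrite -(permKV (phi S (g \o f)) c).
set c' := _ c; rewrite [LHS]shiftE phiC /charge_twist !shiftE -addrA;
  congr (_ + _).
have ex : excess (phi S (g \o f)) c' =
    excess (phi S f) c' + excess (phi (f @: S) g) (phi S f c').
  by rewrite /excess phiC [RHS]addrC addrA subrK.
rewrite /correction -(coherent_extension_image phiE) // mem_imset;
  last exact: perm_inj.
rewrite -(covering_rootset k (graph_auto_covering gA)).
rewrite -imsetI; last by move=> x y _ _; apply: perm_inj.
have -> : phi S f @: rootset k e c' :\: phi S f @: (psi @: S) =
    phi S f @: (rootset k e c' :\: psi @: S).
  apply/setP=> x; rewrite -(permKV (phi S f) x) !inE !mem_imset ?inE //;
  exact: perm_inj.
rewrite !card_imset; try exact: perm_inj.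
by case: ifP => // _; rewrite ex -opprD !mulrDl.
Qed.

Lemma charge_cover_spec :
  let e' := @vcover_edge k V e _ [ffun=> 0] charged in
  exists psi' phi', [/\ rooted_orientation k e', d_embedding k eA e' psi'
    & coherent_extension k eA e' psi' phi'].
Proof.
exists (vsection [ffun=> 0] charged_local shares_charged).
exists (fun S f => mkperm (@twist k V e _ [ffun=> 0] charged (phi S f)
  (charge_twist S f))).
split.
- exact: (vcover_rooted_orientation _ charged_local charged_hereditary).
- apply: (vsection_d_embedding _ charged_local charged_hereditary psiE) => c _.
  move/forallP/(_ c); rewrite connect0 sum_shares.
  by case: (c \in _); rewrite // eq_sym oner_eq0.
apply: (vsection_coherent _ charged_local psiE phiE).
- exact: charge_twistable.
- exact: charge_twist_extends.
- exact: charge_twist_comp.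
move=> S f f' pf ff' r v; have [_ _ phiC] := phiE.
have E : phi S f = phi S f' by apply/permP; apply: phiC.
by rewrite /charge_twist E.
Qed.

End ChargeCover.

(** * Seats: moving cliques of roots into the image *)

Section SeatingCover.
Variables (k : nat) (A V : finType) (eA : rel A) (e : rel V) (psi : A -> V).
Variable phi : {set A} -> (A -> A) -> {perm V}.
Hypothesis eG : rooted_orientation k e.
Hypothesis psiE : d_embedding k eA e psi.
Hypothesis phiE : coherent_extension k eA e psi phi.

Let Psi : {set V} := [set x in codom psi].
Let seat := 'I_#|V|.+1.

Implicit Types U : {set V}.

(** The roots of an irreducible substructure must not project onto such a
    set. *)
Definition stray (U : {set V}) : bool :=
  `[< forall g : {perm V}, graph_auto e g -> ~~ (g @: U \subset Psi) >].

Lemma stray_auto g U : graph_auto e g -> stray (g @: U) = stray U.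
Proof.
move=> gA; apply: asbool_equiv_eq; split=> bU h hA.
  have := bU (g^-1 * h)%g; rewrite -imset_comp.
  rewrite (eq_imset _ (g := h)); last by move=> x; rewrite /= permM permK.
  by apply=> x y; rewrite !permM hA -gA !permKV.
have := bU (g * h)%g; rewrite -imset_comp.
rewrite (eq_imset _ (g := h \o g)); last by move=> x; rewrite /= permM.
by apply=> x y; rewrite !permM hA gA.
Qed.

Lemma stray_leaves U : stray U -> ~~ (U \subset Psi).
Proof.
move/asboolP/(_ 1%g); rewrite (eq_imset _ (g := id)) ?imset_id.
  by apply=> x y; rewrite !perm1.
by move=> x; rewrite perm1.
Qed.

Definition seats (U : {set V}) : {set seat} := [set i : seat | i < #|U|.-1].

Lemma card_seats U : #|seats U| <= #|U|.-1.
Proof.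
rewrite cardE -(size_map val) -[X in _ <= X](size_iota 0).
apply: uniq_leq_size; first by rewrite map_inj_uniq ?enum_uniq //;
  apply: val_inj.
by move=> _ /mapP[i + ->]; rewrite mem_enum inE mem_iota.
Qed.

Lemma seats_auto (g : {perm V}) U : seats (g @: U) = seats U.
Proof. by rewrite /seats card_imset //; apply: perm_inj. Qed.

(** The second clause fixes the values without meaning, so that automorphisms
    can be required to preserve them. *)
Definition seated (D : {set V}) (chi : {ffun V -> {ffun {set V} -> seat}}) :=
  (forall U, stray U -> inj_into (seats U) (D :&: U) (fun r => chi r U)) /\
  (forall U, {in D, forall r, ~~ (stray U && (r \in U)) -> chi r U = ord0}).

Definition seatedb b chi : bool := `[< seated (rootset k e b) chi >].

Lemma seated_sub (D D' : {set V}) chi : D' \subset D -> seated D chi ->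
  seated D' chi.
Proof.
move=> /subsetP DD [c1 c2]; split=> U; last first.
  by move=> r /DD; apply: c2.
move=> /c1[cI cS]; split=> [x y|x] /setIP[/DD xD xU].
  by case/setIP=> /DD yD yU; apply: cI; apply/setIP.
by apply: cS; apply/setIP.
Qed.

Lemma seated_eq (D : {set V}) (chi chi' : {ffun V -> {ffun {set V} -> seat}}) :
  {in D, chi =1 chi'} -> seated D chi -> seated D chi'.
Proof.
move=> E [c1 c2]; split=> U; last by move=> r rD; rewrite -E //; apply: c2.
move=> /c1[cI cS]; split=> [x y|x] xU; have /setIP[xD _] := xU; last first.
  by rewrite -E //; apply: cS.
move=> yU; have /setIP[yD _] := yU; rewrite -!E //; exact: cI.
Qed.

Lemma seatedb_local b (chi chi' : {ffun V -> {ffun {set V} -> seat}}) :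
  {in rootset k e b, chi =1 chi'} -> seatedb b chi -> seatedb b chi'.
Proof. by move=> E /asboolP c; apply/asboolP; apply: seated_eq c. Qed.

Lemma seatedb_hereditary b c chi : e b c -> seatedb b chi -> seatedb c chi.
Proof.
move=> bc /asboolP cb; apply/asboolP; apply: seated_sub cb.
exact: rootset_sub (connect1 bc).
Qed.

(** The elements of U in the copy of A are numbered; there are fewer than
    #|U| of them because a stray U is not contained in the copy of A. *)
Definition rank : {ffun V -> {ffun {set V} -> seat}} :=
  [ffun r => [ffun U : {set V} =>
    if stray U && (r \in U) then inord (index r (enum (U :&: Psi))) else ord0]].

Lemma rank_seated : seated Psi rank.
Proof.
split=> U; last by move=> r _ /negbTE h; rewrite !ffunE h.
move=> bU; have lt r : r \in Psi :&: U -> index r (enum (U :&: Psi)) < #|U|.-1.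
  move=> rU; apply: (@leq_trans #|U :&: Psi|).
    by rewrite [#|_|]cardE index_mem mem_enum setIC.
  rewrite -ltnS prednK; last by apply/card_gt0P; exists r; case/setIP: rU.
  by apply: proper_card; rewrite properEneq subsetIl andbT;
    apply: contraNneq (stray_leaves bU) => /setIidPl.
have lt' r : r \in Psi :&: U -> index r (enum (U :&: Psi)) < #|V|.+1.
  by move=> /lt h; apply: leq_trans h _; apply: leq_trans (leq_pred _) _;
    apply: leq_trans (max_card _) _.
have rankE r : r \in Psi :&: U -> rank r U = inord (index r (enum (U :&: Psi))).
  by case/setIP=> _ rU; rewrite !ffunE bU rU.
split=> [r r' rU rU'|r rU]; rewrite !rankE //.
  move/(congr1 val); rewrite /= !inordK ?lt' //.
  by apply: (@index_inj _ r); rewrite mem_enum setIC.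
by rewrite inE inordK ?lt ?lt'.
Qed.

Lemma rank_seatedb a : seatedb (psi a) rank.
Proof.
apply/asboolP; apply: seated_sub rank_seated.
rewrite -(covering_rootset k (s_embedding_covering psiE.1)).
by apply/subsetP=> _ /imsetP[x _ ->]; rewrite inE codom_f.
Qed.

Section Reseat.
Variables (g : {perm V}) (D : {set V}) (chi : {ffun V -> {ffun {set V} ->
  seat}}).

(** The value permutations that carry a seating chi of D to the seating
    [rank] of its image under g.  With chi := rank they extend partial
    isomorphisms; with the seating found on an irreducible substructure they
    move that substructure to the copy of A. *)
Definition reseat (r : V) (v : {ffun {set V} -> seat}) :
    {ffun {set V} -> seat} :=
  [ffun U : {set V} => let U' := (g^-1)%g @: U in
    if stray U' && (r \in U') then
      carry (seats U') (D :&: U') (fun q => chi q U')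
            (fun q => rank (g q) (g @: U')) (v U')
    else v U'].

Lemma perm_imsetK (U : {set V}) : (g^-1)%g @: (g @: U) = U.
Proof.
rewrite -imset_comp -[RHS]imset_id; apply: eq_imset => x.
by rewrite /= permK.
Qed.

Lemma perm_imsetKV (U : {set V}) : g @: ((g^-1)%g @: U) = U.
Proof.
rewrite -imset_comp -[RHS]imset_id; apply: eq_imset => x.
by rewrite /= permKV.
Qed.

Lemma reseatE r v U : reseat r v (g @: U) =
  if stray U && (r \in U) then
    carry (seats U) (D :&: U) (fun q => chi q U) (fun q =>
      rank (g q) (g @: U)) (v U)
  else v U.
Proof. by rewrite ffunE perm_imsetK. Qed.

Hypothesis gA : graph_auto e g.
Hypothesis gD : g @: D \subset Psi.
Hypothesis chiD : seated D chi.

Lemma rank_auto_seated U : stray U ->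
  inj_into (seats U) (D :&: U) (fun q => rank (g q) (g @: U)).
Proof.
move=> bU; have [/(_ (g @: U)) + _] := rank_seated.
rewrite stray_auto // seats_auto => /(_ bU) [rI rS].
have mem q : q \in D :&: U -> g q \in Psi :&: g @: U.
  by case/setIP=> qD qU; rewrite inE (subsetP gD) imset_f.
split=> [q q' qU qU'|q qU].
  by move/(rI _ _ (mem _ qU) (mem _ qU'))/perm_inj.
exact: rS (mem _ qU).
Qed.

Lemma reseat_inj r : injective (reseat r).
Proof.
move=> v w vw; apply/ffunP=> U; have := congr1 (fun z : {ffun _ ->
  _} => z (g @: U)) vw.
rewrite !reseatE; case: ifP => // /andP[bU _].
by apply: carry_inj; [apply: chiD.1 | apply: rank_auto_seated].
Qed.

Lemma reseat_in r : r \in D -> reseat r (chi r) = rank (g r).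
Proof.
move=> rD; apply/ffunP=> U; rewrite -(perm_imsetKV U) reseatE.
set U' := _ @: U; case: ifP => [/andP[bU rU]|h].
  by rewrite (@carry_in _ _ _ _ (fun q => chi q U')) ?inE ?rD //;
    apply: (chiD.1 _ bU).1.
by rewrite chiD.2 ?h // !ffunE stray_auto // mem_imset ?h //; apply: perm_inj.
Qed.

Lemma reseat_twistable : twistable k e seatedb g reseat.
Proof.
split=> // [|b chi1 chi2 /asboolP[c1 c2] E]; first exact: reseat_inj.
apply/asboolP; rewrite -(covering_rootset k (graph_auto_covering gA)).
split=> U; rewrite -(perm_imsetKV U); set U' := _ @: U; last first.
  move=> _ /imsetP[r rb ->]; rewrite E // stray_auto // mem_imset;
    last exact: perm_inj.
  by move=> h; rewrite reseatE (negbTE h) c2.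
rewrite stray_auto // => bU; have [cI cS] := c1 _ bU.
have chiI := chiD.1 _ bU; have rI := rank_auto_seated bU.
have val r : r \in rootset k e b :&: U' -> chi2 (g r) (g @: U') =
    carry (seats U') (D :&: U') (fun q => chi q U')
      (fun q => rank (g q) (g @: U')) (chi1 r U').
  by case/setIP=> rb rU; rewrite E // reseatE bU rU.
rewrite -imsetI; last by move=> x y _ _; apply: perm_inj.
rewrite seats_auto; split=> [_ _ /imsetP[r rU ->] /imsetP[r' rU' ->]|_
  /imsetP[r rU ->]].
  by rewrite !val // => /(carry_inj chiI rI)/(cI _ _ rU rU')->.
by rewrite val //; apply: carry_sub => //; apply: cS.
Qed.

End Reseat.

Lemma image_in_Psi (S : {set A}) : psi @: S \subset Psi.
Proof. by apply/subsetP=> _ /imsetP[a _ ->]; rewrite inE codom_f. Qed.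

Definition seat_twist (S : {set A}) (f : A -> A) :=
  reseat (phi S f) (psi @: S) rank.

Lemma seat_twistable S f : partial_iso k eA S f ->
  twistable k e seatedb (phi S f) (seat_twist S f).
Proof.
move=> pf; have [/(_ _ _ pf)[gA _] _ _] := phiE.
apply: reseat_twistable => //; first by rewrite (coherent_extension_image
  phiE) // image_in_Psi.
exact: seated_sub (image_in_Psi S) rank_seated.
Qed.

Lemma seat_twist_extends S f : partial_iso k eA S f ->
  {in S, forall a, seat_twist S f (psi a) (rank (psi a)) = rank (psi (f a))}.
Proof.
move=> pf a aS; have [/(_ _ _ pf)[gA pX] _ _] := phiE.
rewrite -pX //; apply: reseat_in => //.
- exact: seated_sub (image_in_Psi S) rank_seated.
exact: imset_f.
Qed.

Lemma seat_twist_comp S f g :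
  partial_iso k eA S f -> partial_iso k eA (f @: S) g -> forall r v,
  seat_twist S (g \o f) r v = seat_twist (f @: S) g (phi S f r) (seat_twist S
    f r v).
Proof.
move=> pf pg r v; have pgf := partial_iso_comp pf pg.
have [phiX phiC _] := phiE; have {}phiC := phiC _ _ _ pf pg.
have [gA pX] := phiX _ _ pf; have [hA hX] := phiX _ _ pg.
have [hgA hgX] := phiX _ _ pgf.
have imC (U : {set V}) : phi S (g \o f) @: U = phi (f @: S) g @: (phi S f @: U).
  by rewrite -imset_comp; apply: eq_imset.
apply/ffunP=> U; rewrite -(perm_imsetKV (phi S (g \o f)) U).
set U' := _ @: U; rewrite [LHS]reseatE imC [RHS]reseatE [in RHS]reseatE.
rewrite stray_auto // mem_imset; last exact: perm_inj.
case: ifP => // /andP[bU rU].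
rewrite seats_auto -(coherent_extension_image phiE) // -imsetI;
  last by move=> x y _ _; apply: perm_inj.
have sS := seated_sub (image_in_Psi S) rank_seated.
have rU1 : inj_into (seats U') (psi @: S :&: U') (fun q =>
  rank q U') := sS.1 _ bU.
have rU2 : inj_into (seats U') (psi @: S :&: U') (fun q =>
  rank (phi S f q) (phi S f @: U')).
  by apply: rank_auto_seated => //; rewrite (coherent_extension_image phiE) //
    image_in_Psi.
have rU3 : inj_into (seats U') (psi @: S :&: U')
    (fun q => rank (phi S (g \o f) q) (phi (f @: S) g @: (phi S f @: U'))).
  by rewrite -imC; apply: rank_auto_seated => //;
    rewrite (coherent_extension_image phiE) // image_in_Psi.
rewrite -(carry_comp (v U') rU1 rU2 rU3); symmetry; apply: carry_reindex => //.
- move=> _ _ /imsetP[x xU ->] /imsetP[y yU ->] /= xy; congr (phi S f _).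
  exact: rU2.1 xy.
- exact: rU2.1.
by move=> q _; rewrite phiC.
Qed.

Let e' := @vcover_edge k V e _ [ffun=> ord0] seatedb.

Definition seat_section : A -> vcover k e [ffun=> ord0] seatedb :=
  vsection [ffun=> ord0] seatedb_local rank_seatedb.

Definition seat_ext (S : {set A}) (f : A -> A) :=
  mkperm (@twist k V e _ [ffun=> ord0] seatedb (phi S f) (seat_twist S f)).

Lemma seat_cover_spec : [/\ rooted_orientation k e', d_embedding k eA e'
  seat_section
  & coherent_extension k eA e' seat_section seat_ext].
Proof.
split.
- exact: (vcover_rooted_orientation _ seatedb_local seatedb_hereditary).
- apply: (vsection_d_embedding _ seatedb_local seatedb_hereditary psiE.1) => c
  cP _.
  exact: psiE.2.
apply: (vsection_coherent _ seatedb_local psiE.1 phiE).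
- exact: seat_twistable.
- exact: seat_twist_extends.
- exact: seat_twist_comp.
move=> S f f' pf ff' r v; have [_ _ phiC] := phiE.
have E : phi S f = phi S f' by apply/permP; apply: phiC.
by rewrite /seat_twist E.
Qed.

(** Two roots in C are roots of one vertex of C, so the projection to the base
    is injective on the roots in C, and all vertices of C agree on one seating
    chi of the projected roots U0.  If U0 were stray, its #|U0| elements would
    have different seats among #|U0| - 1. *)
Lemma seat_cover_faithful (C : {set vcover k e [ffun=> ord0] seatedb}) :
  (forall x y, x \in C -> e' x y -> y \in C) ->
  (forall x y, x \in C -> y \in C -> x \in rootset k e' x ->
    y \in rootset k e' y ->
    exists2 z, z \in C & (x \in rootset k e' z) && (y \in rootset k e' z)) ->
  exists2 g, graph_auto e' g & g @: C \subset codom seat_section.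
Proof.
move=> Cout Cclique.
have Creach x y : x \in C -> connect e' x y -> y \in C.
  by move=> xC; apply: (connect_rec (Q := fun y => y \in C)).
pose RC := [set x in C | x \in rootset k e' x].
have baseI : {in RC &, injective (@base _ _ _ _ _ _)}.
  move=> x y /setIdP[xC xr] /setIdP[yC yr] xy.
  have [z zC /andP[/rootsetP[zx _] /rootsetP[zy _]]] := Cclique _ _ xC yC xr yr.
  have [_ vx] := vcover_reachE zx; have [_ vy] := vcover_reachE zy.
  by apply: vcover_eq => // r rx; rewrite vx // vy // -xy.
pose U0 := (@base _ _ _ _ _ _) @: RC.
pose chi : {ffun V -> {ffun {set V} -> seat}} :=
  [ffun r => if [pick x in RC | base x == r] is Some x then valuation x r else
    [ffun=> ord0]].
have CE b r : b \in C -> r \in rootset k e (base b) ->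
  r \in U0 /\ valuation b r = chi r.
  move=> bC /(vcover_root_lift seatedb_local seatedb_hereditary)[x xb <-].
  have xC : x \in RC.
    rewrite inE (rootset_root xb) andbT; have /rootsetP[bx _] := xb.
    exact: Creach bx.
  split; first exact: imset_f.
  rewrite -(vcover_rootsE seatedb_local seatedb_hereditary xb) ffunE.
  case: pickP => [y /andP[yC /eqP /baseI-> //]|/(_ x)]; by rewrite xC eqxx.
have seatC z : z \in C -> seated (rootset k e (base z)) chi.
  move=> zC; have /asboolP := valuationP z; apply: seated_eq => r rz.
  exact: (CE _ _ zC rz).2.
have U0P r : r \in U0 -> exists2 z, z \in C & r \in rootset k e (base z).
  case/imsetP=> x /setIdP[xC xr] ->; exists x => //.
  exact: (vcover_roots seatedb_local seatedb_hereditary xr).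
have chiU : seated U0 chi.
  split=> U; last by move=> r /U0P[z zC rz]; apply: (seatC _ zC).2.
  move=> bU; split=> [_ _ /setIP[/imsetP[x xRC ->] xU] /setIP[/imsetP[y yRC
    ->] yU]|r].
    have /setIdP[xC xr] := xRC; have /setIdP[yC yr] := yRC.
    have [z zC /andP[zx zy]] := Cclique _ _ xC yC xr yr.
    apply: ((seatC _ zC).1 _ bU).1; apply/setIP; split=> //;
    exact: (vcover_roots seatedb_local seatedb_hereditary).
  case/setIP=> /U0P[z zC rz] rU; apply: ((seatC _ zC).1 _ bU).2.
  exact/setIP.
have bU0 : ~~ stray U0.
  apply/negP=> bU; have [cI cS] := chiU.1 _ bU; rewrite setIid in cI cS.
  have : #|U0| <= #|U0|.-1.
    apply: leq_trans (card_seats U0); rewrite -(card_in_imset cI)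
      subset_leq_card //.
    by apply/subsetP=> _ /imsetP[r rU ->]; apply: cS.
  (* The predecessor of 0 is 0, so the empty set is excluded separately. *)
  have [U00|] := posnP #|U0|; last by case: #|U0| => // n _; rewrite ltnn.
  by have := stray_leaves bU; rewrite (cards0_eq U00) sub0set.
have [g [gA gU]] : exists g, graph_auto e g /\ g @: U0 \subset Psi.
  move/asboolPn: bU0 => /existsNP[g /not_implyP[gA /negP]]; rewrite negbK => gU.
  by exists g.
have tw := reseat_twistable gA gU chiU.
exists (mkperm (@twist k V e _ [ffun=> ord0] seatedb g (reseat g U0 chi))).
  exact: (twist_auto tw).
apply/subsetP=> _ /imsetP[z zC ->]; rewrite mkpermE; last exact: (twist_inj tw).
have [tb tv] := twist_spec tw z.
have rg := covering_rootset k (graph_auto_covering gA) (base z).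
apply: vsectionP; rewrite tb.
  apply: psiE.2; rewrite -rg; apply/subsetP=> _ /imsetP[r rz ->].
  by have := subsetP gU _ (imset_f g (CE _ _ zC rz).1); rewrite inE.
rewrite -rg => _ /imsetP[r rz ->]; have [rU rE] := CE _ _ zC rz.
by rewrite tv // rE; apply: reseat_in.
Qed.

End SeatingCover.

(** * The extension property for rooted orientations *)

(** The last clause is irreducible structure faithfulness, stated for all sets
    closed under out-edges in which any two roots are reached together. *)
Lemma rooted_orientation_EPPA (k : nat) (A : finType) (eA : rel A) :
  0 < k -> rooted_orientation k eA ->
  exists (V : finType) (e : rel V) (psi : A -> V)
      (phi : {set A} -> (A -> A) -> {perm V}),
    [/\ rooted_orientation k e, d_embedding k eA e psi,
        coherent_extension k eA e psi phi
      & forall C : {set V}, (forall x y, x \in C -> e x y -> y \in C) ->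
          (forall x y, x \in C -> y \in C -> x \in rootset k e x ->
            y \in rootset k e y ->
            exists2 z, z \in C & (x \in rootset k e z) && (y \in rootset k e
              z)) ->
          exists2 g, graph_auto e g & g @: C \subset codom psi].
Proof.
move=> k0 gA; have [psi0 [s0 c0]] := pointed_coherent k0 gA.
have [p pV pP] := prime_above #|pointed k A|.
have [psi1 [phi1 [g1 d1 c1]]] := charge_cover_spec (pointed_rooted A k0) s0 c0
  pP pV.
have [g2 d2 c2] := seat_cover_spec g1 d1 c1.
do 4!eexists; split; [exact: g2 | exact: d2 | exact: c2 | move=> C Cout Ccl].
exact: (seat_cover_faithful d1 Cout Ccl).
Qed.

(** * Substructures and irreducibility in the language of d-closures *)

Section Substructures.
Variable L : language.
Implicit Types A : structure L.

Lemma lift_tuple (T : finType) (S : {set T}) n (x : n.-tuple T) :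
  {subset x <= S} ->
  exists t : n.-tuple {y : T | y \in S}, x = map_tuple val t.
Proof.
move=> xS; have tS i : tnth x i \in S by apply/xS/mem_tnth.
exists (mktuple (fun i => exist _ (tnth x i) (tS i))).
by apply: eq_from_tnth => i; rewrite tnth_map tnth_mktuple.
Qed.

(** Relations are induced, so only closure under the functions matters. *)
Lemma substructureP A (S : {set A}) : substructure S <->
  forall F (x : (fun_ar F).-tuple A), {subset x <= S} -> sfun A F x \subset S.
Proof.
split=> [[_ _ fS] F x /lift_tuple[t ->]|SP].
  apply/subsetP=> y; have := fS F t; rewrite -/(incl) => <-.
  by case/imsetP=> z _ ->; apply: (valP z).
split=> [||F x]; [exact: val_inj | by move=> R x; rewrite inE |].
apply/setP=> y; apply/imsetP/idP => [[z]|yx]; first by rewrite inE => zx ->.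
have yS : y \in S.
  apply: (subsetP (SP F (map_tuple val x) _)) yx => _ /mapP[z _ ->].
  exact: (valP z).
by exists (Sub y yS : {x : A | x \in S}); rewrite ?inE.
Qed.

Lemma substructureI A (S T : {set A}) :
  substructure S -> substructure T -> substructure (S :&: T).
Proof.
move=> /substructureP SP /substructureP TP; apply/substructureP=> F x xST.
by rewrite subsetI SP ?TP // => y /xST /setIP[].
Qed.

Lemma substructure_trans A (U : {set A}) (S : {set induced U}) :
  substructure U -> substructure S -> substructure [set val x | x in S].
Proof.
move=> /substructureP UP /substructureP SP; apply/substructureP=> F x xS.
have xU : {subset x <= U} by move=> y /xS /imsetP[z _ ->]; apply: (valP z).
have [t xt] := lift_tuple xU; apply/subsetP=> y yx.
have yU : y \in U by apply: (subsetP (UP F x xU)).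
apply/imsetP; exists (Sub y yU : {x : A | x \in U}) => //.
apply: (subsetP (SP F t _)); last by rewrite inE SubK -xt.
move=> z zt; have /xS/imsetP[w wS /val_inj zw] : val z \in x by rewrite xt
  map_f.
by rewrite zw.
Qed.

End Substructures.

Section DStructures.
Variable k : nat.
Implicit Types H : structure L_graph.

Definition d_structure H : structure L_d := d k (s H).

Lemma ClE H (y : H) : @Cl _ (s H) [set y] = reach (@edge _ _ H) y.
Proof.
apply/setP=> z; rewrite 2!inE; apply/asboolP/idP =>
  [|yz S /substructureP SP]; last first.
  rewrite sub1set => yS; apply: (subsetP (SP (tt : fun_sym L_s) [tuple y] _)).
    by move=> x; rewrite inE => /eqP->.
  by rewrite inE.
move/(_ (reach (@edge _ _ H) y)); rewrite !inE; apply.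
  apply/substructureP=> F x xy; apply/subsetP=> w; rewrite !inE.
  by apply: connect_trans; have := xy _ (mem_tnth ord0 x); rewrite inE.
by rewrite sub1set inE.
Qed.

Lemma rootsE H (y : H) : @Defs.roots k (s H) y = rootset k (@edge _ _ H) y.
Proof. by apply/setP=> r; rewrite [LHS]inE ClE [RHS]inE. Qed.

Definition rooted H := rooted_orientation k (@edge _ _ H).

(** All the added functions are determined by the digraph. *)
Lemma D_dP (A : structure L_d) :
  D_d k A <-> exists2 H, rooted H & A = d_structure H.
Proof.
split=> [[_ [[[H [[o1 o2] ->]] r] ->]]|[H [o1 o2 o3] ->]].
  by exists H => //; split=> // y; rewrite -rootsE.
exists (s H); split=> //; split; first by exists H.
by move=> y; rewrite rootsE.
Qed.

Lemma substructure_dclosed H (S : {set H}) : rooted H ->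
  @substructure _ (d_structure H) S <-> dclosed k (@edge _ _ H) S.
Proof.
move=> [_ _ rH]; split=> [/substructureP SP|[S1 S2]].
  split=> [x y xS xy|y yS].
    apply: (subsetP (SP (Fclosure : fun_sym L_d) [tuple x] _)).
      by move=> z; rewrite inE => /eqP->.
    by rewrite inE; apply: connect1.
  have : 0 < size (enum (rootset k (@edge _ _ H) y)) by rewrite -cardE card_gt0.
  (* The function with the roots of y as its arguments has arity
     (size rs).+1; arity 0 does not occur as y reaches a root. *)
  case E : (enum _) => [//|r0 rs] _.
  have rE z : (z \in r0 :: rs) = (z \in rootset k (@edge _ _ H) y) by rewrite
    -E mem_enum.
  have u : uniq (r0 :: rs) && all (@is_root _ _ (s H) k) (r0 :: rs).
    rewrite -{1}E enum_uniq; apply/allP=> z; rewrite rE => /rootsetP[_]; exact.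
  apply: (subsetP (SP (Froots (size rs) : fun_sym L_d) (in_tuple (r0 :: rs))
    _)).
    by move=> z zx; apply: (subsetP yS); rewrite -rE.
  move: u => /= ->; rewrite inE rootsE; apply/eqP/setP=> z.
  by rewrite inE -rE.
apply/substructureP=> -[|n] x xS; apply/subsetP=> y /=.
  rewrite inE; apply: (connect_rec (Q := fun y => y \in S)) => //.
  by apply: xS; apply: mem_tnth.
case: ifP => _; rewrite inE // rootsE => /eqP yx; apply: S2.
by rewrite yx; apply/subsetP=> z; rewrite inE => /xS.
Qed.

Lemma pairP (T : Type) (x : 2.-tuple T) : exists a b, x = [tuple a; b].
Proof.
by case: x => [[|a [|b [|c t]]]] //= xs; exists a, b; apply: val_inj.
Qed.

Lemma d_embedding_embedding H H' (psi : H -> H') :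
  d_embedding k (@edge _ _ H) (@edge _ _ H') psi ->
  @embedding _ (d_structure H) (d_structure H') psi.
Proof.
move=> [pS pD]; have [pI pE pC] := pS; have cov := s_embedding_covering pS.
split=> // [[] x|[|n] x] /=.
- have [a [b ->]] := pairP x.
  rewrite (_ : map_tuple psi _ = [tuple psi a; psi b]); last exact: val_inj.
  exact/esym/pE.
- have -> : thead (map_tuple psi x) = psi (thead x) by rewrite /thead tnth_map.
  exact: covering_reach cov _.
rewrite map_inj_uniq // all_map.
have -> : all (preim psi (@is_root _ _ (s H') k)) x = all (@is_root _ _ (s H)
  k) x.
  apply: eq_all => y; rewrite /= /is_root; congr (_ < _).
  exact: covering_outdegree cov y.
case: ifP => _; last by rewrite imset0.
apply/setP=> y; rewrite inE rootsE; apply/imsetP/eqP => [[z]|yx].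
  rewrite inE rootsE => /eqP zx ->; rewrite -(covering_rootset k cov) zx.
  apply/setP=> r; rewrite [RHS]inE; apply/imsetP/idP => [[w]|/mapP[w wx ->]].
    by rewrite inE => wx ->; apply: map_f.
  by exists w; rewrite ?inE.
have /codomP[z yz] : y \in codom psi.
  apply: pD; rewrite yx; apply/subsetP=> r; rewrite inE => /mapP[w _ ->].
  exact: codom_f.
exists z => //; rewrite inE rootsE; apply/eqP/setP=> r.
rewrite -(mem_imset _ _ pI) (covering_rootset k cov) -yz yx !inE.
by rewrite mem_map.
Qed.

Lemma graph_auto_automorphism H (g : {perm H}) :
  graph_auto (@edge _ _ H) g -> @automorphism _ (d_structure H) g.
Proof.
move=> gA; split; first by exists (g^-1)%g; [apply: permK | apply: permKV].
apply: d_embedding_embedding.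
have codomT w : w \in codom g by rewrite -(permKV g w) codom_f.
by split; [split=> //; apply: perm_inj|].
Qed.

Section PartialAutomorphisms.
Variables (H H' : structure L_graph) (psi : H -> H').
Let A := d_structure H.
Let B := d_structure H'.
Hypothesis psiD : d_embedding k (@edge _ _ H) (@edge _ _ H') psi.
Hypothesis gH' : rooted H'.
Let image := @image_structure _ A B psi.

Definition point_of (S : {set image}) (x : induced S) : H' := val (val x).

Definition trace (S : {set image}) : {set H} :=
  psi @^-1: [set val x | x in S].

Lemma traceP (S : {set image}) a :
  reflect (exists x : induced S, psi a = point_of x) (a \in trace S).
Proof.
apply: (iffP idP) => [|[x ax]].
  rewrite inE => /imsetP[y yS ay].
  by exists (Sub y yS : {x : image | x \in S}).
by rewrite inE ax; apply: imset_f; apply: (valP x).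
Qed.

Lemma point_ofP (S : {set image}) (x : induced S) :
  exists2 a, a \in trace S & psi a = point_of x.
Proof.
have /imsetP[a _ xa] := valP (val x).
by exists a => //; apply/traceP; exists x.
Qed.

Lemma point_of_inj (S : {set image}) : injective (@point_of S).
Proof. by move=> x y /val_inj/val_inj. Qed.

Lemma edge_point_of (S : {set image}) (x y : induced S) :
  ([tuple x; y] \in srel (induced S) (tt : rel_sym L_d)) =
  edge (point_of x) (point_of y).
Proof.
rewrite !inE; rewrite (_ : map_tuple _ _ = [tuple point_of x; point_of y]) //.
exact: val_inj.
Qed.

Lemma image_substructure : @substructure _ B (psi @: [set: A]).
Proof.
have [pS pD] := psiD; have [_ _ pC] := pS.
apply/substructure_dclosed => //; split=> [x y|y].
  case/imsetP=> a _ ->{x} /pC /codomP[b ->]; exact: imset_f.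
move=> /subsetP ys; have /codomP[b ->] : y \in codom psi.
  by apply: pD; apply/subsetP=> r /ys /imsetP[a _ ->]; apply: codom_f.
exact: imset_f.
Qed.

Lemma trace_dclosed (S : {set image}) :
  substructure S -> dclosed k (@edge _ _ H) (trace S).
Proof.
move=> sS; have [pS pD] := psiD; have [_ pE pC] := pS.
have := substructure_trans image_substructure sS.
move=> /(substructure_dclosed _ gH')[S1 S2]; split=> [x y|y ys]; rewrite !inE.
  by move=> xS xy; apply: S1 xS _; rewrite pE.
apply: S2; rewrite -(covering_rootset k (s_embedding_covering pS)).
by apply/subsetP=> _ /imsetP[r /(subsetP ys) + ->]; rewrite inE.
Qed.

(** A map between substructures of the image, read on A; outside the trace of
    S the value a is a dummy. *)
Definition underlying (S T : {set image}) (f : induced S -> induced T)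
    (a : H) : H :=
  if [pick x : induced S | point_of x == psi a] is Some x then
    if [pick b | psi b == point_of (f x)] is Some b then b else a
  else a.

Lemma underlyingE (S T : {set image}) (f : induced S -> induced T) x a :
  psi a = point_of x -> psi (underlying f a) = point_of (f x).
Proof.
move=> ax; rewrite /underlying; case: pickP => [y /eqP|/(_ x)];
  last by rewrite ax eqxx.
rewrite ax => /point_of_inj ->; case: pickP => [b /eqP //|nb].
by have [b _ bE] := point_ofP (f x); have := nb b; rewrite bE eqxx.
Qed.

Lemma underlying_image (S T : {set image}) (f : induced S -> induced T) :
  partial_automorphism f -> underlying f @: trace S = trace T.
Proof.
case=> _ _ [[h fK hK] _]; apply/setP=> b; apply/imsetP/traceP.
  by case=> a /traceP[x ax] ->; exists (f x); apply: underlyingE.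
case=> y by_; have [a aS ay] := point_ofP (h y); exists a => //.
have [[pI _ _] _] := psiD; apply: pI.
by rewrite by_ (underlyingE f ay) hK.
Qed.

Lemma underlying_partial_iso (S T : {set image}) (f : induced S -> induced T) :
  partial_automorphism f -> partial_iso k (@edge _ _ H) (trace S) (underlying
    f).
Proof.
move=> pf; have [sS sT [fB [fI fE _]]] := pf; have [[pI pE _] _] := psiD.
split; rewrite ?underlying_image //; try exact: trace_dclosed.
  move=> a b /traceP[x ax] /traceP[y by_] /(congr1 psi).
  rewrite (underlyingE f ax) (underlyingE f by_) => /point_of_inj/fI xy.
  by apply: pI; rewrite ax by_ xy.
move=> a b /traceP[x ax] /traceP[y by_]; rewrite -!pE.
rewrite (underlyingE f ax) (underlyingE f by_) ax by_.
rewrite -!edge_point_of (fE (tt : rel_sym L_d) [tuple x; y]).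
by rewrite (_ : map_tuple f _ = [tuple f x; f y]) //; apply: val_inj.
Qed.

Lemma extendsP (S T : {set image}) (f : induced S -> induced T) (g : H' -> H') :
  {in trace S, forall a, g (psi a) = psi (underlying f a)} ->
    @extends _ A B psi S T f g.
Proof.
move=> gE x; have [a aS ax] := point_ofP x.
by have := gE a aS; rewrite (underlyingE f ax) ax.
Qed.

Lemma underlying_comp (S T U : {set image}) (f : induced S -> induced T)
    (g : induced T -> induced U) :
  {in trace S, underlying (g \o f) =1 underlying g \o underlying f}.
Proof.
move=> a /traceP[x ax]; have [[pI _ _] _] := psiD; apply: pI.
by rewrite /= (underlyingE _ ax) (underlyingE g (underlyingE f ax)).
Qed.

Lemma coherent_extension_coherent_map phi :
  coherent_extension k (@edge _ _ H) (@edge _ _ H') psi phi ->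
  @EPPA_map _ A B psi /\ @coherent_map _ A B psi.
Proof.
case=> phi1 phi2 phi3.
have ext (S T : {set image}) (f : induced S -> induced T) :
    partial_automorphism f ->
    @automorphism _ B (phi (trace S) (underlying f)) /\
    @extends _ A B psi S T f (phi (trace S) (underlying f)).
  move=> pf; have [gA gE] := phi1 _ _ (underlying_partial_iso pf).
  by split; [apply: graph_auto_automorphism | apply: extendsP].
split.
  split; first exact: d_embedding_embedding.
  by move=> S T f /ext; exists (phi (trace S) (underlying f)).
exists (fun S T f => phi (trace S) (underlying f)); split; first exact: ext.
move=> S T U f g pf pg x /=.
have qf := underlying_partial_iso pf.
have qg : partial_iso k (@edge _ _ H) (underlying f @: trace S) (underlying g).
  by rewrite underlying_image //; apply: underlying_partial_iso.
rewrite -(phi3 _ _ _ (partial_iso_comp qf qg)); last first.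
  by move=> a aS; rewrite underlying_comp.
by rewrite phi2 // underlying_image.
Qed.

End PartialAutomorphisms.

Section Irreducible.
Variables (H : structure L_graph) (C : {set H}).
Let B := d_structure H.
Let rts (z : @induced _ B C) := rootset k (@edge _ _ H) (val z).

Definition avoiding (u : H) : {set @induced _ B C} := [set z | u \notin rts z].

Lemma avoiding_substructure u : u \in rootset k (@edge _ _ H) u ->
  substructure (avoiding u).
Proof.
move=> uu; apply/substructureP=> F x xS; apply/subsetP=> z zx; rewrite inE.
rewrite inE in zx; have {}xS y : y \in x -> u \notin rts y by move/xS;
  rewrite inE.
case: F x xS zx => [|n] x xS /=.
  rewrite inE /thead tnth_map => xz.
  apply: contra (xS _ (mem_tnth ord0 x)).
  exact: (subsetP (rootset_sub k xz) u).
case: ifP => _; rewrite inE // rootsE => /eqP zx.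
apply/negP; rewrite /rts zx inE => /mapP[w wx uw].
by have := xS _ wx; rewrite /rts -[val w]uw uu.
Qed.

(** The vertices that do not reach u, and those that do not reach v, form proper
    substructures.
    If no vertex reaches both u and v, they cover C.  A tuple in a relation or
    with a nonempty function value has all its roots among the roots of one
    vertex, so it cannot meet both differences. *)
Lemma irreducible_clique u v : irreducible (@induced _ B C) ->
  u \in C -> v \in C -> u \in rootset k (@edge _ _ H) u ->
  v \in rootset k (@edge _ _ H) v ->
  exists2 z, z \in C &
    (u \in rootset k (@edge _ _ H) z) && (v \in rootset k (@edge _ _ H) z).
Proof.
move=> irr uC vC uu vv; apply: contrapT => none; apply: irr.
have no z : ~~ ((u \in rts z) && (v \in rts z)).
  by apply/negP=> h; apply: none; exists (val z) => //; apply: (valP z).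
have meet n (x : n.-tuple (@induced _ B C)) :
    meets_both (avoiding u) (avoiding v) (avoiding u :&: avoiding v) x ->
    exists z1 z2, [/\ z1 \in x, z2 \in x, v \in rts z1 & u \in rts z2].
  have avE w z : (z \in avoiding w) = (w \notin rts z) by rewrite inE.
  case/andP=> /hasP[z1 z1x /setDP[]] + + /hasP[z2 z2x /setDP[]].
  rewrite !in_setI !avE => u1 n1 v2 n2; exists z1, z2; split=> //.
    by move: n1; rewrite u1 negbK.
  by move: n2; rewrite v2 andbT negbK.
have proper w : w \in C -> w \in rootset k (@edge _ _ H) w ->
    avoiding w \proper [set: @induced _ B C].
  move=> wC ww; rewrite properT; apply/eqP=> /setP/(_ (Sub w wC : {x : B | x
    \in C})).
  by rewrite [LHS]inE in_setT /rts SubK ww.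
exists (avoiding u), (avoiding v), (avoiding u :&: avoiding v).
split; [exact: proper | exact: proper |].
have su := avoiding_substructure uu; have sv := avoiding_substructure vv.
split=> //; first by split=> //; apply: substructureI.
- apply/setP=> z; rewrite in_setU in_setT [z \in avoiding u]inE [z \in
  avoiding v]inE.
  by rewrite -negb_and no.
- move=> [] x /meet[z1 [z2 [+ + vz uz]]]; have [a [b ->]] := pairP x.
  move=> z1x z2x; apply/negP; rewrite inE => ab.
  have {}ab : edge (val a : H) (val b).
    by move: ab; rewrite (_ : map_tuple _ _ = [tuple val a; val b]) //;
      apply: val_inj.
  have sub z : z \in [tuple a; b] -> {subset rts z <= rts a}.
    by rewrite !inE => /orP[]/eqP-> // r; apply: rootset_edge.
  by have := no a; rewrite (sub _ z1x v) // (sub _ z2x u).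
move=> [|n] x /meet[z1 [z2 [z1x z2x vz uz]]].
  have th z : z \in x -> z = tnth x ord0.
    by case/tnthP=> i ->; rewrite [i](ord1 i).
  by have := no z1; rewrite vz (th _ z1x) -(th _ z2x) uz.
apply/setP=> z; rewrite [RHS]inE [LHS]inE /=.
case: ifP => _; rewrite inE // rootsE.
apply/negP=> /eqP zx; have /negP[] := no z.
have sub w : w \in x -> {subset rts w <= rts z}.
  move=> wx; apply/subsetP; apply: rootset_mono; rewrite zx inE.
  exact: map_f.
by rewrite (sub _ z2x u) // (sub _ z1x v).
Qed.

End Irreducible.

Definition digraph (V : finType) (e : rel V) : structure L_graph :=
  @Structure L_graph V
    (fun R => [set x : (rel_ar R).-tuple V | e (tnth x ord0) (tnth x ord_max)])
    (fun F => match F with end).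

Lemma edge_digraph (V : finType) (e : rel V) : @edge _ _ (digraph e) = e.
Proof. by apply/funext=> u; apply/funext=> v; rewrite /edge inE. Qed.

End DStructures.

Theorem theorem12p12 (k : nat) (hk : 1 <= k) :
  has_ISF_coherent_EPPA (D_d k).
Proof.
move=> _ /D_dP[H gH ->].
have [V [e [psi [phi [gV dV cV fV]]]]] := rooted_orientation_EPPA hk gH.
pose H' := digraph e.
have gH' : rooted k H' by rewrite /rooted edge_digraph.
exists (d_structure k H'); split; first by apply/D_dP; exists H'.
rewrite -[e](edge_digraph e) in dV cV fV.
have [pE pC] := @coherent_extension_coherent_map k H H' psi dV gH' phi cV.
exists psi; split=> // C /(substructure_dclosed _ gH')[Cout _] irr.
have [|g gA gC] := fV C Cout.
  by move=> x y xC yC xx yy; apply: irreducible_clique irr _ _ _ _.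
exists g; split; first exact: graph_auto_automorphism.
apply: subset_trans gC _; apply/subsetP=> _ /codomP[a ->].
exact: imset_f.
Qed.
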